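(* In the setting described in the context, assume that $\mathcal{A}$ is strongly monotone, i.e. there exists $\alpha>0$ such that $$(\mathcal{A}(w_1)-\mathcal{A}(w_2),w_1-w_2)_H\geq \alpha\|w_1-w_2\|_H^2\quad\text{for all } w_1,w_2\in\mathcal{D}(\mathcal{A}),$$ and that $\mathcal{M}\in\mathcal{C}^1(H,Z)$ satisfies $\mathcal{M}(0)=0$ and $\mathrm{d}\mathcal{M}(w)\mathcal{A}(w)+Cw=0$ for all $w\in\mathcal{D}(\mathcal{A})$. Assume that $\operatorname{Range}\,\mathrm{d}\mathcal{M}(0)B=Z$, i.e. there exists $\lambda>0$ (fixed in what follows) such that $$\|B^*\mathrm{d}\mathcal{M}(0)^*z\|_U^2\geq\lambda\|z\|_Z^2\quad\text{for all } z\in Z.$$ If $\mathrm{d}\mathcal{M}$ is globally (resp. locally) Lipschitz continuous, then there exist positive constants $M$, $\kappa$, $r$ and a neighborhood $\mathcal{N}$ of the origin in $H\times Z$ such that for any $[d,y_{\mathrm{ref}}]$ in $\mathcal{B}_{H\times Z}(0,r)$ (resp. in $\{0\}\times\mathcal{B}_Z(0,r)$) the following results hold for the closed-loop system $$\frac{\mathrm{d}w}{\mathrm{d}t}+\mathcal{A}(w)=BB^*\mathrm{d}\mathcal{M}(w)^*[z-\mathcal{M}(w)]+d,\qquad \frac{\mathrm{d}z}{\mathrm{d}t}=Cw-y_{\mathrm{ref}}. \qquad (\ast)$$ (1) There exists an equilibrium point $[w^\star,z^\star]\in\mathcal{D}(\mathcal{A})\times Z$ of $(\ast)$ lying in $\mathcal{N}$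 such that $Cw^\star=y_{\mathrm{ref}}$ and, for all $[w_0,z_0]\in\mathcal{N}$, the corresponding solution $[w,z]$ of $(\ast)$ with $[w(0),z(0)]=[w_0,z_0]$ satisfies, for all $t\geq0$, $$\|[w(t)-w^\star,z(t)-z^\star]\|_{H\times Z}\leq M\exp(-\kappa t)\,\|[w_0-w^\star,z_0-z^\star]\|_{H\times Z}.$$ (2) Moreover, if $$\|B^*\mathrm{d}\mathcal{M}(w)^*z\|_U^2\geq\lambda\|z\|_Z^2\quad\text{for all } z\in Z \text{ and all } w\in H,$$ then for all $[w_0,z_0]\in H\times Z$ the corresponding solution $[w,z]$ of $(\ast)$ satisfies $[w(t),z(t)]\to[w^\star,z^\star]$ in $H\times Z$ as $t\to+\infty$.
   Context: $H$, $Z$, $U$ are real Hilbert spaces. $\mathcal{A}:\mathcal{D}(\mathcal{A})\to H$ is a single-valued (possibly nonlinear) maximal monotone operator defined on a dense subset $\mathcal{D}(\mathcal{A})\subset H$, with $\mathcal{A}(0)=0$. $B:U\to H$ is a bounded linear map, and $C:\mathcal{D}(C)\to Z$ is a (possibly unbounded) linear map defined on a dense subspace $\mathcal{D}(C)\supset\mathcal{D}(\mathcal{A})$ of $H$. $\mathcal{C}^1(H,Z)$ is the space of continuously Fréchet differentiable maps; $\mathrm{d}\mathcal{M}$ is regarded as a map from $H$ to $\mathcal{L}(H,Z)$ with the operator norm; adjoints are denoted by $^*$. A map is called locally Lipschitz continuous if it is Lipschitz continuous on every bounded set. $\mathcal{B}_X(x,r)$ denotes the open ball of $X$ centered at $x$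 of radius $r$. Strong solution on $[0,T]$: an absolutely continuous function $[w,z]:[0,T]\to H\times Z$ with values in $\mathcal{D}(\mathcal{A})\times Z$ that solves the equations almost everywhere on $(0,T)$. Weak solution on $[0,T]$: a limit in $\mathcal{C}([0,T],H\times Z)$ of strong solutions. ''The corresponding solution'' means the unique weak solution of $(\ast)$ with the given initial condition, which exists on $[0,+\infty)$ whenever $\mathcal{A}$ is strongly monotone (i.e. there exists $\alpha>0$ such that $(\mathcal{A}(w_1)-\mathcal{A}(w_2),w_1-w_2)_H\geq\alpha\|w_1-w_2\|_H^2$ for all $w_1,w_2\in\mathcal{D}(\mathcal{A})$), $\mathcal{M}\in\mathcal{C}^1(H,Z)$ satisfies $\mathcal{M}(0)=0$ and $\mathrm{d}\mathcal{M}(w)\mathcal{A}(w)+Cw=0$ for all $w\in\mathcal{D}(\mathcal{A})$, $\mathrm{d}\mathcal{M}$ is locally Lipschitz continuous, and either $d=0$ or $\mathrm{d}\mathcal{M}$ is globally Lipschitz continuous. An equilibrium point is a point $[w^\star,z^\star]\in\mathcal{D}(\mathcal{A})\times Z$ at which the right-hand sides vanish, i.e. $\mathcal{A}(w^\star)=BB^*\mathrm{d}\mathcal{M}(w^\star)^*[z^\star-\mathcal{M}(w^\star)]+d$ and $Cw^\star=y_{\mathrm{ref}}$. *)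

(* Defs.v *)
From HB Require Import structures.
From mathcomp Require Import all_boot all_order all_algebra.
From mathcomp Require Import all_classical all_reals all_analysis.

Set Implicit Arguments.
Unset Strict Implicit.
Unset Printing Implicit Defensive.

Import Order.TTheory GRing.Theory Num.Theory.
Import numFieldNormedType.Exports.

Local Open Scope classical_set_scope.
Local Open Scope ring_scope.

HB.mixin Record CompleteNormedModule_isHilbert (R : realType) H
    & CompleteNormedModule R H := {
  inner : H -> H -> R;
  innerC : forall x y, inner x y = inner y x;
  innerDl : forall x y z, inner (x + y) z = inner x z + inner y z;
  innerZl : forall (a : R) x y, inner (a *: x) y = a * inner x y;
  inner_norm : forall x, inner x x = `|x| ^+ 2
}.

#[short(type="hilbertType")]
HB.structure Definition Hilbert (R : realType) :=
  {H of CompleteNormedModule_isHilbert R H & CompleteNormedModule R H}.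

Notation "'<[ x , y ]>" := (inner x y)
  (at level 0, x, y at level 99, format "''<[' x ,  y ]>") : ring_scope.

(* The library norm on a product is the maximum of the norms. It induces the
   same topology as the Hilbert norm below, so it is only the quantitative
   statements that have to use the latter. *)
Definition hnorm (R : realType) (H Z : hilbertType R) (p : H * Z) : R :=
  Num.sqrt (`|p.1| ^+ 2 + `|p.2| ^+ 2).

Definition adjoint (R : realType) (X Y : hilbertType R) (f : X -> Y) (y : Y) : X :=
  xget 0 [set x | forall u, '<[f u, y]> = '<[u, x]>].

(* Meaningful for bounded linear f only: sup is 0 on unbounded sets. *)
Definition opnorm (R : realType) (X Y : normedModType R) (f : X -> Y) : R :=
  sup [set `|f x| | x in [set x | `|x| <= 1]].

Definition C1 (R : realType) (X Y : normedModType R) (f : X -> Y) : Prop :=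
  (forall x, differentiable f x) /\
  (forall x, opnorm ('d f x' \- 'd f x) @[x' --> x] --> (0 : R)).

Definition diff_lipschitz_on (R : realType) (X Y : normedModType R)
    (f : X -> Y) (S : set X) : Prop :=
  exists L : R, forall x1 x2, S x1 -> S x2 ->
    opnorm ('d f x1 \- 'd f x2) <= L * `|x1 - x2|.

Definition diff_globally_lipschitz (R : realType) (X Y : normedModType R)
    (f : X -> Y) : Prop :=
  diff_lipschitz_on f setT.

Definition diff_locally_lipschitz (R : realType) (X Y : normedModType R)
    (f : X -> Y) : Prop :=
  forall S : set X, bounded_set S -> diff_lipschitz_on f S.

(* Partially defined maps are total functions paired with their domain; their
   values outside of the domain are never used. *)
Definition linear_with_domain (R : realType) (X Y : normedModType R)
    (E : set X) (f : X -> Y) : Prop :=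
  E 0 /\ forall (a : R) x y, E x -> E y ->
    E (a *: x + y) /\ f (a *: x + y) = a *: f x + f y.

Definition graph_on (X Y : Type) (E : set X) (f : X -> Y) : set (X * Y) :=
  [set p | E p.1 /\ p.2 = f p.1].

Definition monotone_graph (R : realType) (H : hilbertType R) (G : set (H * H)) :
    Prop :=
  forall p q, G p -> G q -> 0 <= '<[p.2 - q.2, p.1 - q.1]>.

Definition maximal_monotone (R : realType) (H : hilbertType R)
    (DA : set H) (A : H -> H) : Prop :=
  monotone_graph (graph_on DA A) /\
  forall G, monotone_graph G -> graph_on DA A `<=` G -> G `<=` graph_on DA A.

Definition strongly_monotone (R : realType) (H : hilbertType R)
    (DA : set H) (A : H -> H) : Prop :=
  exists2 alpha : R, 0 < alpha & forall w1 w2, DA w1 -> DA w2 ->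
    alpha * `|w1 - w2| ^+ 2 <= '<[A w1 - A w2, w1 - w2]>.

Definition absolutely_continuous_on (R : realType) (V : normedModType R)
    (a b : R) (x : R -> V) : Prop :=
  forall e : R, 0 < e -> exists2 delta : R, 0 < delta &
    forall (n : nat) (s t : 'I_n -> R),
      (forall i, [/\ a <= s i, s i <= t i & t i <= b]) ->
      trivIset setT (fun i => `]s i, t i[%classic) ->
      \sum_(i < n) (t i - s i) < delta ->
      \sum_(i < n) `|x (t i) - x (s i)| < e.

Definition feedback (R : realType) (H Z U : hilbertType R)
    (B : U -> H) (M : H -> Z) (w : H) (z : Z) : H :=
  B (adjoint B (adjoint ('d M w) (z - M w))).

(* Only the restriction of x to [0, T] matters: the derivatives are taken at
   interior points. *)
Definition strong_solution (R : realType) (H Z U : hilbertType R)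
    (DA : set H) (A : H -> H) (B : U -> H) (C : H -> Z) (M : H -> Z)
    (d : H) (yref : Z) (T : R) (x : R -> H * Z) : Prop :=
  let w t := (x t).1 in
  let z t := (x t).2 in
  [/\ absolutely_continuous_on 0 T x,
      forall t, 0 <= t <= T -> DA (w t) &
      {ae lebesgue_measure, forall t : R, 0 < t < T ->
         [/\ derivable w t 1,
             'D_1 w t + A (w t) = feedback B M (w t) (z t) + d,
             derivable z t 1 &
             'D_1 z t = C (w t) - yref]}].

Definition weak_solution_on (R : realType) (H Z U : hilbertType R)
    (DA : set H) (A : H -> H) (B : U -> H) (C : H -> Z) (M : H -> Z)
    (d : H) (yref : Z) (T : R) (x : R -> H * Z) : Prop :=
  exists xn : nat -> R -> H * Z,
    (forall n, strong_solution DA A B C M d yref T (xn n)) /\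
    {uniform `[0, T]%classic, xn @ \oo --> x}.

Definition weak_solution (R : realType) (H Z U : hilbertType R)
    (DA : set H) (A : H -> H) (B : U -> H) (C : H -> Z) (M : H -> Z)
    (d : H) (yref : Z) (x : R -> H * Z) : Prop :=
  forall T : R, 0 < T -> weak_solution_on DA A B C M d yref T x.

Definition equilibrium (R : realType) (H Z U : hilbertType R)
    (DA : set H) (A : H -> H) (B : U -> H) (C : H -> Z) (M : H -> Z)
    (d : H) (yref : Z) (p : H * Z) : Prop :=
  [/\ DA p.1, A p.1 = feedback B M p.1 p.2 + d & C p.1 = yref].

(* Main.v *)
Require Import Defs.
From HB Require Import structures.
From mathcomp Require Import all_boot all_order all_algebra.
From mathcomp Require Import all_classical all_reals all_analysis.
From mathcomp Require Import ring lra.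

(** The change of variable e = z - M(w) decouples the unbounded part of the
    system. Write D(w) for the differential of M at w and P(w) = B* D(w)*.
    The Sylvester equation D(w) A(w) + C w = 0 cancels the term C w, and the
    closed loop becomes

      w' + A(w) = B P(w) e + d,      e' = - yref - D(w) (B P(w) e + d).

    The first equation is strongly monotone; since D(w) B is the adjoint of
    P(w), the second one is dissipative as soon as P(w) is bounded below,
    which the range condition gives for w near the origin. A weighted sum of
    squares V = eta |w - w1|^2 + |e - e1|^2, with eta small, is then a
    Lyapunov function: half of its derivative is at most - kappa V near an
    equilibrium ([local_lyap_rate]) and, under the global lower bound, at most
    - kappa V plus a constant of the order of the squared data when it is
    centred at the origin ([global_lyap_rate]).

    In these variables an equilibrium solves e = - G(w)^-1 (yref + D(w) d),
    with G(w) = D(w) B P(w), and w = A^-1 (B P(w) e + d); for small data this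
    is a fixed point problem for a contraction ([equilibrium_exists]). It
    requires A to be onto, which is Minty's theorem. Minty's theorem, the
    Riesz theorem behind adjoints and the Lax-Milgram theorem behind G(w)^-1
    all follow from one fact, the attainment of the maximum of a strongly
    concave function on a convex set ([sharp_maximum]).

    For strong solutions V is absolutely continuous and its derivative is
    known almost everywhere only, so decay rests on the fact that an
    absolutely continuous function with nonpositive derivative almost
    everywhere is nonincreasing ([absolutely_continuous_nonincreasing]). The
    resulting bounds survive uniform limits, hence hold for weak solutions.

    The two Lipschitz hypotheses enter in the same way: both give a Lipschitz
    constant l of D on the unit ball, and both give
    |D(w) d| <= (k0 + l |w|) |d| for all w, the local one because then d = 0.
    Both also make M Lipschitz on bounded sets, which absolute continuity of
    V requires. *)

Set Implicit Arguments.
Unset Strict Implicit.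
Unset Printing Implicit Defensive.

Import Order.TTheory GRing.Theory Num.Theory.
Import numFieldNormedType.Exports.

Local Open Scope classical_set_scope.
Local Open Scope ring_scope.

(** * Elementary inequalities *)

Section RealInequalities.
Variable R : realType.

(** Young's inequality, stated for the discriminant c ^+ 2 <= 4 * p * q of the
    quadratic form, so that the free parameter of the usual form never has to
    be chosen. *)
Lemma young (p q c x y : R) : 0 < p -> c ^+ 2 <= 4 * p * q ->
  c * x * y <= p * x ^+ 2 + q * y ^+ 2.
Proof.
move=> p0 h; rewrite -subr_ge0 -(pmulr_rge0 _ p0).
have -> : p * (p * x ^+ 2 + q * y ^+ 2 - c * x * y) =
  (p * x - c * y / 2) ^+ 2 + (4 * p * q - c ^+ 2) * y ^+ 2 / 4 by field.
by rewrite addr_ge0 ?sqr_ge0// divr_ge0// mulr_ge0 ?sqr_ge0// subr_ge0.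
Qed.

Lemma sqr_le_of_le_add (x y w m : R) : 0 <= x -> x <= y + m * w ->
  x ^+ 2 <= 2 * y ^+ 2 + 2 * m ^+ 2 * w ^+ 2.
Proof.
move=> x0 xyw; apply: (@le_trans _ _ ((y + m * w) ^+ 2)).
  by rewrite ler_pXn2r// ?nnegrE//; exact: le_trans xyw.
by have := sqr_ge0 (y - m * w); lra.
Qed.

(** From 1 + s <= expR s alone; T is an explicit entrance time. *)
Lemma expRN_eventually_lt (k c a : R) : 0 < k -> 0 <= c -> 0 < a ->
  exists2 T : R, 0 <= T & forall t, T <= t -> expR (- (k * t)) * c < a.
Proof.
move=> k0 c0 a0; have ak0 : 0 < a * k by exact: mulr_gt0.
exists (c / (a * k)); first by rewrite divr_ge0// ltW.
move=> t; rewrite ler_pdivrMr// => ct.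
have ee0 := expR_gt0 (- (k * t)).
have ee1 : expR (- (k * t)) * (1 + k * t) <= 1.
  by rewrite expRN mulrC ler_pdivrMr ?expR_gt0// mul1r; exact: expR_ge1Dx.
have := ler_wpM2l (ltW ee0) ct; have := ler_wpM2l (ltW a0) ee1.
by have := mulr_gt0 a0 ee0; lra.
Qed.

(** All smallness conditions on the radius r are brought to the linear form a
    * r < c, so that one radius serves finitely many of them; r <= 1 allows
    quadratic conditions to be reduced to linear ones. *)
Lemma small_radius (s : seq (R * R)) :
  (forall p, p \in s -> 0 < p.1 /\ 0 < p.2) ->
  exists r : R, [/\ 0 < r, r <= 1 & forall p, p \in s -> p.1 * r < p.2].
Proof.
elim: s => [_|[a c] s IHs pos]; first by exists 1.
have [|r [r0 r1 rs]] := IHs; first by move=> p ps; apply: pos; rewrite inE ps orbT.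
have [/= a0 c0] := pos (a, c) (mem_head _ _).
have ac0 : 0 < c / (2 * a) by rewrite divr_gt0// mulr_gt0.
exists (Num.min r (c / (2 * a))); split.
- by rewrite lt_min r0.
- by rewrite ge_min r1.
move=> p; rewrite inE => /predU1P[->/=|ps].
  apply: (@le_lt_trans _ _ (a * (c / (2 * a)))).
    by rewrite ler_pM2l// ge_min lexx orbT.
  have -> : a * (c / (2 * a)) = c / 2 by field; rewrite gt_eqF.
  by lra.
apply: le_lt_trans (rs _ ps); rewrite ler_wpM2l ?ge_min ?lexx//.
by have [|/ltW] := pos p; rewrite // inE ps orbT.
Qed.

End RealInequalities.

(** * Hilbert space geometry: sharp maxima, Riesz representation, adjoints *)

Section InnerProduct.
Variables (R : realType) (H : hilbertType R).
Implicit Types x y z : H.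

Lemma innerDr x y z : '<[x, y + z]> = '<[x, y]> + '<[x, z]>.
Proof. by rewrite innerC innerDl !(innerC x). Qed.

Lemma innerZr (a : R) x y : '<[x, a *: y]> = a * '<[x, y]>.
Proof. by rewrite innerC innerZl innerC. Qed.

Lemma innerNl x y : '<[- x, y]> = - '<[x, y]>.
Proof. by rewrite -scaleN1r innerZl mulN1r. Qed.

Lemma innerNr x y : '<[x, - y]> = - '<[x, y]>.
Proof. by rewrite innerC innerNl innerC. Qed.

Lemma innerBl x y z : '<[x - y, z]> = '<[x, z]> - '<[y, z]>.
Proof. by rewrite innerDl innerNl. Qed.

Lemma innerBr x y z : '<[x, y - z]> = '<[x, y]> - '<[x, z]>.
Proof. by rewrite innerDr innerNr. Qed.

Lemma inner0l x : '<[0, x]> = 0.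
Proof. by rewrite -(scale0r x) innerZl mul0r. Qed.

Lemma inner0r x : '<[x, 0]> = 0.
Proof. by rewrite innerC inner0l. Qed.

Definition innerE :=
  (@innerDl R H, innerDr, innerBl, innerBr, innerNl, innerNr, @innerZl R H, innerZr).

Lemma sqr_normD x y :
  `|x + y| ^+ 2 = `|x| ^+ 2 + 2 * '<[x, y]> + `|y| ^+ 2.
Proof. by rewrite -!inner_norm !innerE (innerC y x); ring. Qed.

Lemma sqr_normB x y :
  `|x - y| ^+ 2 = `|x| ^+ 2 - 2 * '<[x, y]> + `|y| ^+ 2.
Proof. by rewrite -!inner_norm !innerE (innerC y x); ring. Qed.

Lemma sqr_normZ (a : R) x : `|a *: x| ^+ 2 = a ^+ 2 * `|x| ^+ 2.
Proof. by rewrite -!inner_norm !innerE; ring. Qed.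

Lemma inner_le x y : '<[x, y]> <= `|x| * `|y|.
Proof.
have [->|x0] := eqVneq x 0; first by rewrite inner0l normr0 mul0r.
have [->|y0] := eqVneq y 0; first by rewrite inner0r normr0 mulr0.
have nx : 0 < `|x| by rewrite normr_gt0.
have ny : 0 < `|y| by rewrite normr_gt0.
have : 0 <= `| `|y| *: x - `|x| *: y | ^+ 2 by rewrite exprn_ge0.
rewrite sqr_normB !sqr_normZ !innerE.
have := mulr_gt0 nx ny; set p := `|x| * `|y| => p0 h.
have {}h : 0 <= p * (2 * (p - '<[x, y]>)).
  by apply: le_trans h _; rewrite le_eqVlt; apply/orP; left; apply/eqP;
     rewrite /p; ring.
by move: h; rewrite pmulr_rge0 // pmulr_rge0 // subr_ge0.
Qed.

Lemma inner_ge x y : - (`|x| * `|y|) <= '<[x, y]>.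
Proof. by rewrite lerNl -innerNl -(normrN x) inner_le. Qed.

Lemma inner_polar x y :
  '<[x, y]> = (`|x + y| ^+ 2 - `|x - y| ^+ 2) / 4.
Proof. by rewrite sqr_normD sqr_normB; field. Qed.

Lemma cvg_sqr_norm (T : Type) (F : set_system T) (FF : Filter F)
    (f : T -> H) (a : H) :
  f @ F --> a -> (fun t => `|f t| ^+ 2) @ F --> (`|a| ^+ 2 : R).
Proof.
move=> fa; have fn : (fun t => `|f t|) @ F --> (`|a| : R) by exact: cvg_norm.
by rewrite expr2; under eq_fun do rewrite expr2; exact: cvgM.
Qed.

Lemma cvg_inner (T : Type) (F : set_system T) (FF : Filter F)
    (f g : T -> H) (a b : H) :
  f @ F --> a -> g @ F --> b ->
  (fun t => '<[f t, g t]>) @ F --> ('<[a, b]> : R).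
Proof.
move=> fa gb; under eq_fun do rewrite inner_polar.
rewrite inner_polar; apply: cvgMl.
by apply: cvgB; apply: cvg_sqr_norm; [exact: cvgD|exact: cvgB].
Qed.

Lemma sqr_norm_lipschitz (a a' : H) (k : R) :
  `|a| <= k -> `|a'| <= k ->
  `| `|a| ^+ 2 - `|a'| ^+ 2 | <= 2 * k * `|a - a'|.
Proof.
move=> ak a'k; rewrite subr_sqr normrM mulrC.
apply: ler_pM => //; last exact: ler_dist_dist.
by rewrite ger0_norm ?addr_ge0//; lra.
Qed.

Lemma norm_le_of_inner (v : H) (k : R) :
  '<[v, v]> <= k * `|v| -> 0 <= k -> `|v| <= k.
Proof.
move=> h k0; have [->|v0] := eqVneq v 0; first by rewrite normr0.
by move: h; rewrite inner_norm expr2 ler_pM2r// normr_gt0.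
Qed.

(** Testing against all vectors turns an identity between vectors into one
    between real numbers, which the ring tactic can decide. *)
Lemma inner_inj x y : (forall v, '<[x, v]> = '<[y, v]>) -> x = y.
Proof.
move=> h; apply/eqP; rewrite -subr_eq0 -normr_eq0 -sqrf_eq0 -inner_norm.
by rewrite innerBl h subrr.
Qed.

(** The function (b, c) |-> 2 c - |b|^2 is strongly concave in b. By the
    parallelogram law the b-components of a maximizing sequence in the convex
    set K form a Cauchy sequence, and letting t tend to 0 in the bound along
    the segment from the sequence to p gives the first-order optimality
    condition, sharpened by |p.1 - b|^2. This is the only place where
    completeness enters the duality arguments: both the Riesz representation
    theorem and Minty's theorem are instances, for suitable K. *)
Lemma sharp_maximum (K : set (H * R)) (m : R) :
  K !=set0 ->
  (forall p q (t : R), K p -> K q -> 0 <= t <= 1 ->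
     K (p.1 + t *: (q.1 - p.1), p.2 + t * (q.2 - p.2))) ->
  (forall p, K p -> 2 * p.2 - `|p.1| ^+ 2 <= m) ->
  exists b : H, forall p, K p -> 2 * p.2 - `|p.1| ^+ 2 + `|p.1 - b| ^+ 2 <= m.
Proof.
move=> [p0 Kp0] Kconv Km.
pose D (p : H * R) : R := 2 * p.2 - `|p.1| ^+ 2.
pose S := [set D p | p in K].
have S_sup : has_sup S.
  by split; [exists (D p0), p0|exists m => _ [p Kp <-]; exact: Km].
pose s := sup S.
have Ds p : K p -> D p <= s by move=> Kp; apply: ub_le_sup;
   [case: S_sup|exists p].
have sm : s <= m by apply: ge_sup; [case: S_sup|move=> _ [p Kp <-]; exact: Km].
have [e [e0 edec ecvg]] : exists e : nat -> R,
    [/\ forall n, 0 < e n, forall n k, (n <= k)%N -> e k <= e n &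
       e @ \oo --> (0 : R)].
  exists (fun n => n.+1%:R^-1); split => [n|n k nk|]; last exact: cvg_harmonic.
    by rewrite invr_gt0.
  by rewrite lef_pV2 ?posrE// ler_nat ltnS.
have esmall d : 0 < d -> exists N, e N < d.
  move=> d0; move/cvgrPdist_lt : ecvg => /(_ d d0)[N _ /(_ N (leqnn N))].
  by rewrite sub0r normrN gtr0_norm//; exists N.
have /choice[p pP] : forall n : nat, exists p, K p /\ s - e n < D p.
  move=> n; have [_ [q Kq <-] ?] := @sup_adherent _ S (e n) (e0 n) S_sup.
  by exists q.
(* D along the segment from p n to q is a quadratic polynomial in t, and it
   stays below the supremum s. *)
have step q n (t : R) : K q -> 0 <= t <= 1 ->
    t * (D q + `|q.1 - (p n).1| ^+ 2 - D (p n)) <=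
      e n + t ^+ 2 * `|q.1 - (p n).1| ^+ 2.
  move=> Kq t01; have [Kp Dp] := pP n.
  have := Ds _ (Kconv _ _ t Kp Kq t01); rewrite /D/= sqr_normD sqr_normZ.
  rewrite sqr_normB !innerE inner_norm (innerC q.1); move: Dp; rewrite /D.
  by move=> *; lra.
(* Parallelogram law, in the form of the previous bound with t = 1/2 from
   p N to p n. *)
have pcauchy : cvgn (fun n => (p n).1).
  apply/cauchy_cvgP/cauchy_exP => d d0.
  have [N N0] : exists N, 8 * e N < d ^+ 2.
    have [|N ?] := esmall (d ^+ 2 / 8); first by rewrite divr_gt0// exprn_gt0.
    by exists N; lra.
  exists (p N).1; exists N => // n /= Nn.
  have [Kn Dn] := pP n; have := step (p n) N (1/2) Kn.
  have half : 0 <= (1 / 2 : R) <= 1 by apply/andP; split; lra.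
  move=> /(_ half).
  have n1N := edec _ _ Nn.
  have := Ds _ (pP N).1.
  move=> h1 h2.
  rewrite -ball_normE/= -(ltr_pXn2r (n := 2)) ?nnegrE ?normr_ge0 ?ltW//.
  by rewrite distrC; have := e0 N; lra.
move/cvg_ex: pcauchy => [/= b pb]; exists b => q Kq.
have cD : (fun n => D (p n)) @ \oo --> s.
  apply/cvgrPdist_le => d d0.
  have [N N0] := esmall _ d0.
  exists N => // n /= Nn; have [Kn Dn] := pP n; have := Ds _ Kn.
  have n1N := edec _ _ Nn.
  by move=> ?; rewrite ger0_norm; lra.
have cN : (fun n => `|q.1 - (p n).1| ^+ 2) @ \oo --> (`|q.1 - b| ^+ 2 : R).
  by apply: cvg_sqr_norm; apply: cvgB => //; exact: cvg_cst.
have lims t : 0 <= t <= 1 ->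
    t * (D q + `|q.1 - b| ^+ 2 - s) <= t ^+ 2 * `|q.1 - b| ^+ 2.
  move=> t01; rewrite -[leRHS]add0r.
  apply: (ler_cvg_to (f := fun n => t * (D q + `|q.1 - (p n).1| ^+ 2 - D (p n))) (a := \oo)
    (g := fun n => e n + t ^+ 2 * `|q.1 - (p n).1| ^+ 2)).
  - by apply: cvgMr; apply: cvgB => //; apply: cvgD => //; exact: cvg_cst.
  - by apply: cvgD => //; apply: cvgMr.
  - by apply: nearW => n; exact: step.
apply: le_trans _ sm; rewrite -/(D q); set a := `|q.1 - b| ^+ 2 in lims *.
have a0 : 0 <= a by rewrite exprn_ge0.
rewrite leNgt; apply/negP => hlt.
pose g := D q + a - s; have g0 : 0 < g by rewrite subr_gt0.
have g1 : 0 < g + 2 * a + 1 by lra.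
(* If the claim fails by g > 0, this t in ]0, 1] contradicts the bound, as
   t * a < g. *)
pose t := g / (g + 2 * a + 1).
have t0 : 0 < t by rewrite divr_gt0.
have tE : t * (g + 2 * a + 1) = g by rewrite /t divfK// gt_eqF.
have t1 : t <= 1 by rewrite /t ler_pdivrMr// mul1r; lra.
have := lims t; rewrite (ltW t0) t1 => /(_ isT).
rewrite expr2 -mulrA ler_pM2l// -/g -tE => h.
have : t * (g + a + 1) <= 0 by lra.
by rewrite leNgt pmulr_rgt0// => /negP; apply; lra.
Qed.

(** Apply [sharp_maximum] to the graph of l: then l - <b, .> is bounded above,
    and a linear form that is bounded above vanishes. *)
Lemma riesz (l : H -> R) (k : R) :
  (forall a x y, l (a *: x + y) = a * l x + l y) ->
  (forall x, `|l x| <= k * `|x|) ->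
  exists b, forall x, l x = '<[b, x]>.
Proof.
move=> lin lk.
have l0 : l 0 = 0.
  by have := lin 1 0 0; rewrite scaler0 addr0 mul1r => /eqP;
    rewrite addrC -subr_eq subrr eq_sym => /eqP.
have lD x y : l (x + y) = l x + l y by rewrite -[x]scale1r lin mul1r scale1r.
have lZ a x : l (a *: x) = a * l x by rewrite -[a *: x]addr0 lin l0 addr0.
have [||p [x _ <-]/=|b hb] := @sharp_maximum [set (x, l x) | x in setT] (k ^+ 2).
- by exists (0, l 0), 0.
- move=> _ _ t [x _ <-] [y _ <-] _ /=; exists (x + t *: (y - x)) => //.
  by rewrite lD lZ lD -[- x]scaleN1r lZ mulN1r.
- have := lk x; rewrite ler_norml => /andP[_ h].
  have : 0 <= (k - `|x|) ^+ 2 by rewrite sqr_ge0.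
  by rewrite sqrrB; lra.
have {}hb x : 2 * (l x - '<[b, x]>) + `|b| ^+ 2 <= k ^+ 2.
  have /hb : [set (x, l x) | x in setT] (x, l x) by exists x.
  by rewrite /= sqr_normB (innerC x); lra.
exists b => x; apply/eqP; rewrite -subr_eq0; apply: contraT => ne.
pose f := l x - '<[b, x]>.
(* The linear form l - <b, .> takes the value (k^2 + 1) / 2 there, more than
   its upper bound k^2 / 2. *)
have := hb (((k ^+ 2 + 1) / 2 / f) *: x).
rewrite lZ innerZr -mulrBr divfK//.
have : 0 <= `|b| ^+ 2 by rewrite exprn_ge0.
by lra.
Qed.

End InnerProduct.

(** The Riesz theorem makes the description that defines [adjoint]
    satisfiable. *)
Lemma adjointP (R : realType) (X Y : hilbertType R) (f : {linear X -> Y})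
  (y : Y) (u : X) : continuous f -> '<[f u, y]> = '<[u, adjoint f y]>.
Proof.
move=> fc; rewrite /adjoint.
suff [b hb] : exists b, forall u, '<[f u, y]> = '<[u, b]>.
  by case: xgetP => [a _ ->//|/(_ b)/=]; case.
have [k hk] : exists k : R, forall x, `|f x| <= k * `|x|.
  have /linear_boundedP/pinfty_ex_gt0 := continuous_linear_bounded 0 (fc 0).
  by case=> k k0 hk; exists k.
have [a x z|x|b hb] := @riesz R X (fun u => '<[f u, y]>) (k * `|y|).
- by rewrite linearP innerDl innerZl.
- have h1 := inner_le (f x) y; have h2 := inner_ge (f x) y.
  have h3 := ler_wpM2r (normr_ge0 y) (hk x).
  by rewrite ler_norml; apply/andP; split; lra.
by exists b => v; rewrite hb innerC.
Qed.

(** * Minty's theorem and its consequences *)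

Section Minty.
Variables (R : realType) (H : hilbertType R).

(** The point u solves a minimax problem: all the affine constraints |u|^2 +
    <u, y - x> - <x, y> <= 0, for (x, y) in G, have to hold together, and the
    dual function on the convex hull of the triples (x, y, <x, y>) is 2 c -
    |b|^2 with b = (x - y) / 2 and c = - <x, y> / 2. On a triple (X, Y, s) of
    the hull it is at most - |X + Y|^2 / 4, provided that <X, Y> <= s. Convex
    combinations are avoided by replacing the hull by F and F' together: F is
    the polar of G for the Fitzpatrick pairing, F' is the polar of F, both are
    convex and contain the triples by monotonicity, and pairing an element of
    their intersection with itself gives <X, Y> <= s. *)
Lemma minty_extension (G : set (H * H)) : monotone_graph G ->
  exists u, forall p, G p -> 0 <= '<[p.2 + u, p.1 - u]>.
Proof.
move=> Gmono.
have [->|[p0 Gp0]] : G = set0 \/ G !=set0.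
  by have [->|/set0P] := eqVneq G set0; [left|right].
  by exists 0.
(* The inequalities of the polars F and F' are affine in p, hence the sets
   they define are convex. *)
pose F (p : H * H * R) := forall q, G q ->
  0 <= p.2 - '<[p.1.1, q.2]> - '<[q.1, p.1.2]> + '<[q.1, q.2]>.
pose F' (p : H * H * R) := forall q, F q ->
  0 <= p.2 + q.2 - '<[p.1.1, q.1.2]> - '<[q.1.1, p.1.2]>.
have GF p : G p -> F (p, '<[p.1, p.2]>).
  move=> Gp q Gq /=; have := Gmono _ _ Gp Gq; rewrite !innerE.
  by rewrite (innerC p.2) (innerC p.2) (innerC q.2) (innerC q.2); lra.
have GF' p : G p -> F' (p, '<[p.1, p.2]>).
  by move=> Gp q /(_ _ Gp) /=; lra.
pose K := [set ((1/2) *: (p.1.1 - p.1.2), - (1/2) * p.2) | p in F `&` F'].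
have [|_ _ t [p [Fp Fp'] <-] [q [Fq Fq'] <-] /andP[t0 t1]|_ [p [Fp Fp'] <-]|u hu] :=
    @sharp_maximum R H K 0.
- exists ((1/2) *: (p0.1 - p0.2), - (1/2) * '<[p0.1, p0.2]>).
  by exists (p0, '<[p0.1, p0.2]>) => //; split; [exact: GF|exact: GF'].
- exists (p.1.1 + t *: (q.1.1 - p.1.1), p.1.2 + t *: (q.1.2 - p.1.2),
          p.2 + t * (q.2 - p.2)).
    split=> r Gr /=; rewrite !innerE.
      have := mulr_ge0 t0 (Fq r Gr).
      have := mulr_ge0 (_ : 0 <= 1 - t) (Fp r Gr); rewrite subr_ge0 => /(_ t1).
      by lra.
    have := mulr_ge0 t0 (Fq' r Gr).
    have := mulr_ge0 (_ : 0 <= 1 - t) (Fp' r Gr); rewrite subr_ge0 => /(_ t1).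
    by lra.
  rewrite /=; congr pair; last by ring.
  by apply: inner_inj => v; rewrite !innerE; ring.
- have := Fp' _ Fp; rewrite /= sqr_normZ sqr_normB.
  have : 0 <= `|p.1.1 + p.1.2| ^+ 2 by rewrite exprn_ge0.
  by rewrite sqr_normD; lra.
exists u => p Gp.
have /hu : K ((1/2) *: (p.1 - p.2), - (1/2) * '<[p.1, p.2]>).
  by exists (p, '<[p.1, p.2]>) => //; split; [exact: GF|exact: GF'].
rewrite /= sqr_normB !innerE inner_norm.
by rewrite (innerC p.2 p.1) (innerC u p.1) (innerC p.2 u); lra.
Qed.

(** [minty_extension] for the graph of (A - f) / alpha - id, which is
    monotone. *)
Lemma strongly_monotone_extension (D : set H) (A : H -> H) (alpha : R) (f : H) :
  0 < alpha ->
  (forall x y, D x -> D y ->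
    alpha * `|x - y| ^+ 2 <= '<[A x - A y, x - y]>) ->
  exists u, forall x, D x -> 0 <= '<[A x - f, x - u]>.
Proof.
move=> alpha0 Amono.
have [_ _ [x Dx <-] [y Dy <-]|u hu] :=
  @minty_extension [set (x, alpha^-1 *: (A x - f) - x) | x in D].
  rewrite (_ : _.2 - _.2 = alpha^-1 *: (A x - A y) - (x - y)); last first.
    by apply: inner_inj => v; rewrite /= !innerE; ring.
  by rewrite innerBl innerZl inner_norm subr_ge0 ler_pdivlMl// Amono.
exists u => x Dx; have /= := hu _ (ex_intro2 _ _ x Dx erefl).
rewrite -addrA innerDl innerZl [- x + u]addrC -[u - x]opprB innerNl inner_norm.
rewrite subr_ge0 ler_pdivlMl// => /(le_trans _); apply.
by rewrite mulr_ge0 ?exprn_ge0// ltW.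
Qed.

(** Adding (u, f) to the graph keeps it monotone, so maximality puts it there
    already. *)
Lemma strongly_monotone_surjective (D : set H) (A : H -> H) :
  maximal_monotone D A -> strongly_monotone D A ->
  forall f, exists2 w, D w & A w = f.
Proof.
move=> [Amono Amax] [alpha alpha0 Astrong] f.
have [u hu] := strongly_monotone_extension f alpha0 Astrong.
have : graph_on D A (u, f).
  apply: (Amax (graph_on D A `|` [set (u, f)])); last by right.
    move=> p q [Gp|->] [Gq|->] /=.
    - exact: Amono.
    - by case: Gp => Dp ->; exact: hu.
    - case: Gq => Dq ->; rewrite -opprB -[u - _]opprB innerNl innerNr opprK.
      exact: hu.
    - by rewrite !subrr inner0l.
  by left.
by case=> /= Du fE; exists u.
Qed.

(** G is everywhere defined, so that the extension inequality may be tested at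
    u + t v for all v and t; its part of first order in t must vanish. *)
Lemma lax_milgram (G : H -> H) (mu : R) :
  (forall a x y, G (a *: x + y) = a *: G x + G y) -> 0 < mu ->
  (forall x, mu * `|x| ^+ 2 <= '<[G x, x]>) ->
  forall f, exists u, G u = f.
Proof.
move=> Glin mu0 Gcoer f.
have GB x y : G x - G y = G (x - y).
  by rewrite addrC -scaleN1r -Glin scaleN1r addrC.
have [|u hu] := @strongly_monotone_extension setT G mu f mu0.
  by move=> x y _ _; rewrite GB.
exists u; apply: inner_inj => v; apply/eqP.
rewrite -subr_eq0 -innerBl; set c := '<[_, _]>.
pose k := '<[G v, v]>.
have k0 : 0 <= k by apply: le_trans (Gcoer v); rewrite mulr_ge0 ?exprn_ge0// ltW.
have k1 : 0 < k + 1 by lra.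
(* With this t, t c + t^2 k >= 0 amounts to - t^2 >= 0. *)
pose t := - c / (k + 1).
have tE : t * (k + 1) = - c by rewrite /t divfK// gt_eqF.
have := hu (t *: v + u) I; rewrite addrK Glin -addrA innerDl innerZl !innerZr.
rewrite -/k -/c => h.
have : t ^+ 2 <= 0.
  have ttE : t * (t * (k + 1)) = t * - c by rewrite tE.
  move: h ttE; rewrite -/k; move: (k) (c) (t) => k_ c_ t_; lra.
rewrite exprn_even_le0//= => /eqP t0.
by rewrite -[c]opprK -tE t0 mul0r oppr0.
Qed.

End Minty.

(** * Monotonicity of absolutely continuous functions *)

Section AbsolutelyContinuous.
Variable R : realType.
Local Notation mu := (@lebesgue_measure R).

(** A nonpositive derivative at c controls increments only over intervals that
    contain c. *)
Lemma derive_le0_straddle (f : R -> R) (c e : R) : 0 < e ->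
  derivable f c 1 -> 'D_1 f c <= 0 ->
  exists2 h : R, 0 < h & forall s y, c - h < s -> s <= c -> c <= y -> y < c + h ->
    f y - f s <= e * (y - s).
Proof.
move=> e0 /cvgrPdist_lt/(_ e e0) /nbhs_ballP[h /= h0 hh] D0.
have q k : `|k| < h -> k != 0 -> k^-1 * (f (k + c) - f c) < e.
  move=> kh k0; have := hh k; rewrite -ball_normE/= sub0r normrN => /(_ kh k0).
  rewrite -/('D_1 f c) ltr_norml /GRing.scale/= mulr1 => /andP[+ _].
  by lra.
have right y : c <= y -> y < c + h -> f y - f c <= e * (y - c).
  rewrite le_eqVlt => /predU1P[<-|cy] yh; first by rewrite !subrr mulr0.
  have yc : 0 < y - c by rewrite subr_gt0.
  have := q (y - c); rewrite subrK gtr0_norm// gt_eqF// => /(_ _ isT) qe.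
  by rewrite mulrC -ler_pdivrMl//; apply/ltW/qe; lra.
have left s : c - h < s -> s <= c -> f c - f s <= e * (c - s).
  move=> hs; rewrite le_eqVlt => /predU1P[->|sc]; first by rewrite !subrr mulr0.
  have yc : s - c < 0 by rewrite subr_lt0.
  have := q (s - c); rewrite subrK ltr0_norm// lt_eqF// => /(_ _ isT) qe.
  have : e * (s - c) <= f s - f c by rewrite mulrC -ler_ndivrMl//; apply/ltW/qe; lra.
  by lra.
by exists h => // s y hs sc cy yh; have := right _ cy yh; have := left _ hs sc; lra.
Qed.

(** Cover the exceptional null set by an open set W of measure less than the
    delta that absolute continuity attaches to e. Say that s is reachable (P
    s) if f s - f a is at most e * (s - a) plus the increments of f over
    finitely many disjoint intervals contained in W and in [a, s]. Each c has
    a neighbourhood in which one can step from any s <= c to any y >= c: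
    either the derivative at c bounds the increment, or ]s, y[ lies in W and
    is added to the family. Hence the supremum of the reachable points is b,
    and at b absolute continuity bounds the increments over the family by e. *)
Lemma absolutely_continuous_nonincreasing (f : R -> R) (a b : R) : a <= b ->
  absolutely_continuous_on a b f ->
  {ae mu, forall t : R, a < t < b -> derivable f t 1 /\ 'D_1 f t <= 0} ->
  f b <= f a.
Proof.
move=> ab fAC [N [mN N0 bad]].
suff key (e : R) : 0 < e -> f b <= f a + e * (b - a) + e.
  apply/ler_addgt0Pr => e e0.
  have ba1 : 0 < b - a + 1 by lra.
  have := key (e / (b - a + 1)) (divr_gt0 e0 ba1).
  have : e / (b - a + 1) * (b - a + 1) = e by rewrite divfK// gt_eqF.
  by set q := e / _; lra.
move=> e0; have [delta delta0 fdelta] := fAC e e0.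
(* The end points are exceptional as well: no derivative is known there. *)
pose E := N `|` [set a] `|` [set b].
have mE : measurable E.
  by apply: measurableU; [apply: measurableU => //|]; exact: measurable_set1.
have E0 : mu E = 0%E.
  apply: (measure_negligible mE).
  apply: negligibleU; [apply: negligibleU|]; apply/(negligibleP mu) => //;
    (exact: measurable_set1) || (exact: lebesgue_measure_set1).
have [W [oW EW mW]] : exists W : set R, [/\ open W, E `<=` W & (mu W < delta%:E)%E].
  have [|W [oW EW mW]] := lebesgue_regularity_outer mE _ delta0.
    by rewrite -[ltLHS]/(mu E) E0.
  exists W; split => //; rewrite -(setDUK EW).
  apply: le_lt_trans (measureU2 _ _ _) _ => //.
    by apply: measurableD => //; exact: measurable_realfun.open_measurable.
  by rewrite -[X in (X + _)%E]/(mu E) E0 add0e.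
(* The family l is listed from right to left, so that the interval that is
   added last comes first. *)
pose P s := exists l : seq (R * R),
  [/\ forall p, p \in l -> [/\ a <= p.1, p.1 <= p.2 & p.2 <= s],
     pairwise (fun p q : R * R => q.2 <= p.1) l,
     ((\sum_(p <- l) (p.2 - p.1))%:E <= mu (W `&` `]-oo, s]))%E &
     f s - f a <= e * (s - a) + \sum_(p <- l) `|f p.2 - f p.1|].
have Pa : P a.
  exists [::]; split=> //; rewrite ?big_nil ?measure_ge0//.
  by rewrite !subrr mulr0 addr0.
have Pstep s y : a <= s -> s < y -> P s ->
    f y - f s <= e * (y - s) \/ `]s, y[ `<=` W -> P y.
  move=> as_ sy [l [lin lpw lmu lf]] [fe|syW].
    exists l; split => //.
    - by move=> p /lin[? ? ?]; split => //; lra.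
    - apply: le_trans lmu _; apply: le_measure; rewrite ?inE.
      + by apply: measurableI => //; exact: measurable_realfun.open_measurable.
      + by apply: measurableI => //; exact: measurable_realfun.open_measurable.
      + by move=> x [Wx /=]; rewrite ?in_itv/= => xs; split=> //=; rewrite ?in_itv/=; lra.
    - by lra.
  exists ((s, y) :: l); split.
  - move=> p; rewrite inE => /predU1P[->/=|/lin[? ? ?]]; first by split => //; lra.
    by split => //; lra.
  - rewrite /= lpw andbT; apply/allP => p /lin[? ? ?]/=; lra.
  - rewrite big_cons/= EFinD addeC.
    apply: (@le_trans _ _ (mu ((W `&` `]-oo, s]) `|` `]s, y[))).
      rewrite measureU//; [|by apply: measurableI => //;
        exact: measurable_realfun.open_measurable|].
        apply: leeD => //; rewrite -[leRHS]/(mu _) lebesgue_measure_itv/= lte_fin sy.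
        by rewrite -EFinB.
      by rewrite -subset0 => x [[_ /=]]; rewrite ?in_itv/= => xs /andP[sx _]; lra.
    apply: le_measure; rewrite ?inE.
    + apply: measurableU => //; apply: measurableI => //.
      exact: measurable_realfun.open_measurable.
    + by apply: measurableI => //; exact: measurable_realfun.open_measurable.
    + move=> x [[Wx /=]|sxy]; rewrite ?in_itv/=.
        by move=> xs; split=> //=; rewrite ?in_itv/=; lra.
      by split; [exact: syW|move: sxy; rewrite /= !in_itv/= => /andP[_ /ltW]].
  - rewrite big_cons/=; have := ler_norm (f y - f s).
    have : 0 <= e * (y - s) by rewrite mulr_ge0 ?subr_ge0// ltW.
    by lra.
have loc c : a <= c -> c <= b -> exists2 h : R, 0 < h & forall s y,
    c - h < s -> s <= c -> c <= y -> y < c + h ->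
    f y - f s <= e * (y - s) \/ `]s, y[ `<=` W.
  move=> ac cb; have [Ec|nEc] := pselect (E c).
    have := oW; rewrite openE => /(_ c (EW _ Ec)) /nbhs_ballP[h /= h0 hW].
    exists h => // s y hs sc cy yh; right => x /=; rewrite in_itv/= => /andP[sx xy].
    by apply: hW; rewrite -ball_normE/= ltr_norml; apply/andP; split; lra.
  have acb : a < c < b.
    by rewrite !lt_neqAle ac cb !andbT; apply/andP; split; apply/eqP => ce;
      apply: nEc; [left; right|right]; rewrite /= ce.
  have [df Df] : derivable f c 1 /\ 'D_1 f c <= 0.
    by apply: contrapT => nd; apply: nEc; left; left; apply: bad => /= /(_ acb).
  by have [h h0 hh] := derive_le0_straddle e0 df Df; exists h => // *; left; exact: hh.
pose S := [set s | a <= s <= b /\ P s].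
have S_sup : has_sup S.
  split; first by exists a; split=> //; rewrite lexx.
  by exists b => s [/andP[]].
have aS : a <= sup S by apply: ub_le_sup; [case: S_sup|split=> //; rewrite lexx].
have Sb : sup S <= b by apply: ge_sup; [case: S_sup|move=> s [/andP[]]].
have [h h0 hh] := loc _ aS Sb.
have [s [/andP[as_ sb] Ps] hs] := sup_adherent h0 S_sup.
have sS : s <= sup S by apply: ub_le_sup; [case: S_sup|split=> //; rewrite as_].
pose y := Num.min b (sup S + h / 2).
have Py : P y.
  have [sy|] := ltP s y.
    apply: Pstep sy Ps _ => //; apply: hh => //.
      by rewrite /y le_min Sb/=; lra.
    by rewrite /y gt_min; apply/orP; right; lra.
  rewrite /y ge_min => /orP[bs|]; last by lra.
  have bE : b = s by apply/eqP; rewrite eq_le bs sb.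
  by rewrite /y min_l -?bE//; first (by rewrite bE); lra.
have yS : y <= sup S.
  apply: ub_le_sup; [by case: S_sup|split=> //].
  by rewrite /y ge_min lexx/= andbT le_min ab/=; lra.
have yb : y = b.
  by move: yS; rewrite /y; case: (leP b (sup S + h / 2)) => // _ ?; exfalso; lra.
move: Py; rewrite yb => -[l [lin lpw lmu lf]].
suff : \sum_(p <- l) `|f p.2 - f p.1| < e by lra.
have lt_l i : (i < size l)%N -> nth (0, 0) l i \in l by exact: mem_nth.
rewrite (big_nth (0, 0)) big_mkord; apply: fdelta => /=.
- by move=> i; apply: lin; exact: mem_nth.
- apply/trivIsetP => i j _ _ ij; rewrite -subset0 => x [/=].
  rewrite ?in_itv/= => /andP[x1 x2] /andP[x3 x4].
  have pw k1 k2 : (k1 < k2 < size l)%N -> (nth (0,0) l k2).2 <= (nth (0,0) l k1).1.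
    move=> /andP[k12 k2l]; move/(pairwiseP (0, 0)) : lpw; apply => //.
    by rewrite inE; exact: ltn_trans k12 k2l.
  have : (i < j)%N || (j < i)%N by rewrite -neq_ltn.
  by case/orP => lt; [have := pw i j|have := pw j i]; rewrite lt ltn_ord => /(_ isT); lra.
- rewrite -lte_fin; apply: le_lt_trans mW; apply: le_trans (le_trans lmu _).
    by rewrite (big_nth (0, 0)) big_mkord.
  apply: le_measure; rewrite ?inE; last by move=> x [].
    by apply: measurableI => //; exact: measurable_realfun.open_measurable.
  exact: measurable_realfun.open_measurable.
Qed.

End AbsolutelyContinuous.

(** * Operator norms and calculus in Hilbert spaces *)

Section OperatorNorm.
Variables (R : realType) (X Y : normedModType R).

(** Boundedness is needed for the supremum that defines [opnorm] to be
    meaningful. *)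
Lemma opnorm_ub (f : X -> Y) (k : R) :
  (forall a x, f (a *: x) = a *: f x) -> (forall x, `|f x| <= k * `|x|) ->
  forall x, `|f x| <= opnorm f * `|x|.
Proof.
move=> fZ fk x; have [->|x0] := eqVneq x 0.
  by rewrite -[in f _](scale0r (0 : X)) fZ scale0r !normr0 mulr0.
have nx : 0 < `|x| by rewrite normr_gt0.
rewrite -ler_pdivrMr// mulrC.
have -> : `|x|^-1 * `|f x| = `|f (`|x|^-1 *: x)|.
  by rewrite fZ normrZ ger0_norm// invr_ge0.
apply: ub_le_sup; last first.
  exists (`|x|^-1 *: x) => //=.
  by rewrite normrZ ger0_norm ?invr_ge0// mulVf ?gt_eqF.
exists `|k| => _ [y /= y1 <-]; apply: le_trans (fk y) _.
apply: le_trans (ler_norm _) _; rewrite normrM normr_id.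
by rewrite ler_piMr.
Qed.

Lemma continuous_linear_bound (f : {linear X -> Y}) : continuous f ->
  exists2 k : R, 0 < k & forall x, `|f x| <= k * `|x|.
Proof.
move=> fc; have /linear_boundedP/pinfty_ex_gt0 :=
  continuous_linear_bounded 0 (fc 0).
by case=> k k0 hk; exists k.
Qed.

Lemma diff_lipschitz_onP (f : X -> Y) (S : set X) :
  (forall x, differentiable f x) -> diff_lipschitz_on f S ->
  exists2 L : R, 0 < L & forall x1 x2 v, S x1 -> S x2 ->
    `|'d f x1 v - 'd f x2 v| <= L * `|x1 - x2| * `|v|.
Proof.
move=> df [L fL]; exists (`|L| + 1); first by rewrite ltr_wpDl.
move=> x1 x2 v S1 S2.
have [k1 k10 fk1] := continuous_linear_bound (diff_continuous (df x1)).
have [k2 k20 fk2] := continuous_linear_bound (diff_continuous (df x2)).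
apply: (@le_trans _ _ (opnorm ('d f x1 \- 'd f x2) * `|v|)).
  apply: (@opnorm_ub _ (k1 + k2)) => [a x|x] /=.
    by rewrite scalerBr !linearZ.
  by rewrite mulrDl; apply: le_trans (ler_normB _ _) _; exact: lerD.
rewrite ler_wpM2r//; apply: le_trans (fL _ _ S1 S2) _.
by rewrite ler_wpM2r//; apply: le_trans (ler_norm L) _; rewrite lerDl.
Qed.

End OperatorNorm.

Section HilbertCalculus.
Variables (R : realType) (H : hilbertType R).

(** The difference quotient is exactly the inner product of f (t + h) + f t
    with the difference quotient of f. *)
Lemma is_derive_sqr_norm (f : R -> H) (t : R) (df : H) :
  is_derive t 1 f df -> is_derive t 1 (fun s => `|f s| ^+ 2) (2 * '<[f t, df]>).
Proof.
move=> [fdrv fE].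
have fcont : f @ t --> f t.
  exact/differentiable_continuous/derivable1_diffP.
have lim : (fun h => h^-1 *: (`|f (h *: 1 + t)| ^+ 2 - `|f t| ^+ 2)) @ 0^'
    --> 2 * '<[f t, df]>.
  have -> : (fun h : R => h^-1 *: (`|f (h *: 1 + t)| ^+ 2 - `|f t| ^+ 2)) =
    (fun h => '<[f (h *: 1 + t) + f t, h^-1 *: (f (h *: 1 + t) - f t)]>).
    apply/funext => h; rewrite innerZr !innerE !inner_norm (innerC (f t)).
    by rewrite /GRing.scale/=; congr (_ * _); ring.
  have -> : 2 * '<[f t, df]> = '<[f t + f t, df]> by rewrite innerDl; ring.
  apply: cvg_inner; last by rewrite -fE; exact: fdrv.
  apply: cvgD; last exact: cvg_cst.
  apply: (@cvg_comp _ _ _ (fun h : R => h *: 1 + t) f _ (nbhs t)) => //.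
  apply: cvg_trans (_ : (fun h : R => h *: 1 + t) @ 0 --> t).
    by apply: cvg_app; exact: cvg_within.
  rewrite -[X in _ --> X]add0r -[X in _ --> X + _](scale0r (1 : R^o)).
  by apply: cvgD; [apply: cvgZl; exact: cvg_id|exact: cvg_cst].
split; first by apply/cvg_ex; exists (2 * '<[f t, df]>).
exact: cvg_lim lim.
Qed.

Lemma is_derive_inner_cst (f : R -> H) (v : H) (t : R) (df : H) :
  is_derive t 1 f df -> is_derive t 1 (fun s => '<[f s, v]>) '<[df, v]>.
Proof.
move=> [fdrv fE].
have lim : (fun h => h^-1 *: ('<[f (h *: 1 + t), v]> - '<[f t, v]>)) @ 0^'
    --> ('<[df, v]> : R).
  have -> : (fun h : R => h^-1 *: ('<[f (h *: 1 + t), v]> - '<[f t, v]>)) =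
    (fun h => '<[h^-1 *: (f (h *: 1 + t) - f t), v]>).
    by apply/funext => h; rewrite innerZl innerBl.
  by apply: cvg_inner; [rewrite -fE; exact: fdrv|exact: cvg_cst].
split; first by apply/cvg_ex; exists '<[df, v]>.
exact: cvg_lim lim.
Qed.

End HilbertCalculus.

Lemma is_derive_comp_diff (R : realType) (X Y : normedModType R) (f : X -> Y)
    (g : R -> X) (t : R) (dg : X) :
  differentiable f (g t) -> is_derive t 1 g dg ->
  is_derive t 1 (f \o g) ('d f (g t) dg).
Proof.
move=> df [/derivable1_diffP gdrv gE].
have dfg : differentiable (f \o g) t by exact: differentiable_comp.
split; first exact/derivable1_diffP.
by rewrite deriveE// diff_comp//= -gE (deriveE _ gdrv).
Qed.

(** The scalar mean value theorem, applied to the inner product of f along the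
    segment with f x - f y. *)
Lemma mean_value_inequality (R : realType) (X : normedModType R)
    (Y : hilbertType R) (f : X -> Y) (k : R) (x y : X) :
  (forall z, differentiable f z) ->
  (forall (t : R) v, 0 <= t <= 1 -> `|'d f (y + t *: (x - y)) v| <= k * `|v|) ->
  `|f x - f y| <= k * `|x - y|.
Proof.
move=> df fk.
pose g (t : R) := y + t *: (x - y).
have dg (t : R) : is_derive t 1 g (x - y).
  have [gd gE] : is_derive t 1 (fun s : R => s *: (x - y)) (x - y).
    have lim : (fun h : R => h^-1 *: ((h *: 1 + t) *: (x - y) - t *: (x - y)))
       @ 0^' --> x - y.
      apply: cvg_near_cst; apply: filterS (nbhs_dnbhs_neq _) => h h0.
      by rewrite -scalerBl addrK scalerA [h *: 1]mulr1 mulVf// scale1r.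
    split; first by apply/cvg_ex; exists (x - y).
    exact: cvg_lim lim.
  split; first by apply: derivableD => //; exact: derivable_cst.
  by rewrite deriveD//; rewrite derive_cst add0r gE.
pose v := f x - f y.
have dphi (t : R) : is_derive t 1 (fun s => '<[(f \o g) s, v]>)
    '<['d f (g t) (x - y), v]>.
  by apply: is_derive_inner_cst; exact: is_derive_comp_diff.
have [c c01 cE] := @MVT _ (fun s => '<[(f \o g) s, v]>)
  (fun t => '<['d f (g t) (x - y), v]>) 0 1 ltr01 (fun t _ => dphi t)
  (derivable_within_continuous (fun t _ => @ex_derive _ _ _ _ _ _ _ (dphi t))).
have g0 : g 0 = y by rewrite /g scale0r addr0.
have g1 : g 1 = x by rewrite /g scale1r addrC subrK.
move: cE; rewrite subr0 mulr1 /= g0 g1 -innerBl.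
rewrite -/v inner_norm => vE.
have [->|v0] := eqVneq v 0.
  rewrite normr0; have [->|xy] := eqVneq (x - y) 0; first by rewrite normr0 mulr0.
  by have := fk 0 (x - y); rewrite lexx ler01 => /(_ isT); apply: le_trans.
have nv : 0 < `|v| by rewrite normr_gt0.
rewrite -(ler_pM2r nv) -expr2 vE; apply: le_trans (inner_le _ _) _.
rewrite ler_wpM2r//; apply: fk.
by move: c01; rewrite in_itv/= => /andP[c0 c1]; rewrite !ltW.
Qed.

(** * Absolute continuity and Gronwall's inequality *)

Section AbsoluteContinuityCalculus.
Variable R : realType.

Lemma absolutely_continuous_sub (V : normedModType R) (x : R -> V)
    (a b a' b' : R) : a <= a' -> b' <= b ->
  absolutely_continuous_on a b x -> absolutely_continuous_on a' b' x.
Proof.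
move=> aa' b'b xAC e e0; have [delta delta0 h] := xAC e e0.
exists delta => // n s t st; apply: h => i; have [? ? ?] := st i.
by split => //; lra.
Qed.

Lemma absolutely_continuous_dominated (V W : normedModType R) (x : R -> V)
    (y : R -> W) (a b L : R) :
  absolutely_continuous_on a b x ->
  (forall s t, a <= s <= b -> a <= t <= b -> `|y t - y s| <= L * `|x t - x s|) ->
  absolutely_continuous_on a b y.
Proof.
move=> xAC yx e e0.
have L1 : 0 < `|L| + 1 by rewrite ltr_wpDl.
have [delta delta0 h] := xAC (e / (`|L| + 1)) (divr_gt0 e0 L1).
exists delta => // n s t st dis len; have := h n s t st dis len.
rewrite ltr_pdivlMr// mulrC mulr_sumr; apply: le_lt_trans.
apply: ler_sum => i _; have [asi sti tib] := st i.
apply: le_trans (yx _ _ _ _) _; [apply/andP; split; lra|apply/andP; split; lra|].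
by rewrite ler_wpM2r//; apply: le_trans (ler_norm L) _; rewrite lerDl.
Qed.

Lemma absolutely_continuous_uniform (V : normedModType R) (x : R -> V)
    (a b e : R) : absolutely_continuous_on a b x -> 0 < e ->
  exists2 delta : R, 0 < delta & forall s t, a <= s <= b -> a <= t <= b ->
    `|t - s| < delta -> `|x t - x s| < e.
Proof.
move=> xAC e0; have [delta delta0 h] := xAC e e0; exists delta => //.
have le s t : a <= s -> s <= t -> t <= b -> t - s < delta -> `|x t - x s| < e.
  move=> as_ st tb std.
  have := h 1%N (fun=> s) (fun=> t); rewrite !big_ord1; apply => //.
  by apply/trivIsetP => i j _ _; rewrite !ord1 eqxx.
move=> s t /andP[as_ sb] /andP[at_ tb] std.
have [st|ts] := leP s t.
  by apply: le => //; rewrite -(ger0_norm (_ : 0 <= t - s))// subr_ge0.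
rewrite distrC; apply: le => //; first exact: ltW.
by rewrite distrC in std; apply: le_lt_trans std; exact: ler_norm.
Qed.

Lemma absolutely_continuous_bounded (V : normedModType R) (x : R -> V)
    (a b : R) : absolutely_continuous_on a b x -> a <= b ->
  exists2 k : R, 0 < k & forall t, a <= t <= b -> `|x t| <= k.
Proof.
move=> xAC ab.
have [|c _ cmax] := @EVT_max R (fun t => `|x t|) a b ab.
  apply/subspace_continuousP => t /=; rewrite in_itv/= => tab.
  apply/cvgrPdist_lt => e e0.
  have [delta delta0 h] := absolutely_continuous_uniform xAC e0.
  apply/nbhs_ballP; exists delta => //= s; rewrite -ball_normE/= => ts.
  rewrite in_itv/= => sab; apply: le_lt_trans (ler_dist_dist _ _) _.
  exact: h.
exists (`|x c| + 1); first by rewrite ltr_wpDl.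
by move=> t tab; apply: le_trans (cmax t _) _; rewrite ?in_itv// lerDl.
Qed.

Lemma absolutely_continuousM (f g : R -> R) (a b : R) : a <= b ->
  absolutely_continuous_on a b f -> absolutely_continuous_on a b g ->
  absolutely_continuous_on a b (f \* g).
Proof.
move=> ab fAC gAC e e0.
have [kf kf0 fk] := absolutely_continuous_bounded fAC ab.
have [kg kg0 gk] := absolutely_continuous_bounded gAC ab.
have [d1 d10 h1] := fAC _ (divr_gt0 e0 (mulr_gt0 (ltr0n R 2) kg0)).
have [d2 d20 h2] := gAC _ (divr_gt0 e0 (mulr_gt0 (ltr0n R 2) kf0)).
exists (Num.min d1 d2); first by rewrite lt_min d10.
move=> n s t st dis; rewrite lt_min => /andP[len1 len2].
have := h1 n s t st dis len1; have := h2 n s t st dis len2.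
rewrite !ltr_pdivlMr ?mulr_gt0// => b2 b1.
apply: (@le_lt_trans _ _ (kg * (\sum_(i < n) `|f (t i) - f (s i)|) +
                          kf * (\sum_(i < n) `|g (t i) - g (s i)|))); last by lra.
rewrite !mulr_sumr -big_split/=; apply: ler_sum => i _.
have [asi sti tib] := st i.
have -> : f (t i) * g (t i) - f (s i) * g (s i) =
  (f (t i) - f (s i)) * g (t i) + f (s i) * (g (t i) - g (s i)) by ring.
apply: le_trans (ler_normD _ _) _; rewrite !normrM.
apply: lerD; last by rewrite ler_wpM2r// fk//; apply/andP; split; lra.
by rewrite mulrC ler_wpM2r// gk//; apply/andP; split; lra.
Qed.

Lemma absolutely_continuous_id (a b : R) : absolutely_continuous_on a b (@id R).
Proof.
move=> e e0; exists e => // n s t st _; apply: le_lt_trans.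
by apply: ler_sum => i _; have [_ ? _] := st i; rewrite ger0_norm// subr_ge0.
Qed.

(** On a half-line bounded above the exponential is Lipschitz, by convexity. *)
Lemma absolutely_continuous_expR (k a b : R) : 0 <= k ->
  absolutely_continuous_on a b (fun t => expR (k * t)).
Proof.
move=> k0.
apply: (absolutely_continuous_dominated (L := expR (k * b) * k)
  (@absolutely_continuous_id a b)).
have le s t : s <= t -> t <= b ->
    `|expR (k * t) - expR (k * s)| <= expR (k * b) * k * `|t - s|.
  move=> st tb; rewrite !ger0_norm ?subr_ge0//; last first.
    by rewrite ler_expR ler_wpM2l.
  have -> : expR (k * s) = expR (k * t) * expR (k * (s - t)).
    by rewrite -expRD; congr expR; ring.
  have := expR_ge1Dx (k * (s - t)) => h.
  have tb' : expR (k * t) <= expR (k * b) by rewrite ler_expR ler_wpM2l.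
  apply: (@le_trans _ _ (expR (k * t) * (k * (t - s)))).
    have := ler_wpM2l (expR_ge0 (k * t)) h; lra.
  rewrite -mulrA ler_wpM2r// mulr_ge0// subr_ge0//.
move=> s t /andP[as_ sb] /andP[at_ tb].
have [st|ts] := leP s t; first exact: le.
by rewrite distrC [`|id t - _|]distrC; apply: le => //; exact: ltW.
Qed.

Lemma ae_mono (P Q : R -> Prop) : (forall t, P t -> Q t) ->
  {ae @lebesgue_measure R, forall t, P t} ->
  {ae @lebesgue_measure R, forall t, Q t}.
Proof.
by move=> PQ [N [mN N0 bad]]; exists N; split => // t nQ; apply: bad => /PQ.
Qed.

(** The function expR (k t) * f t is absolutely continuous with a nonpositive
    derivative almost everywhere. *)
Lemma gronwall (f : R -> R) (k a b : R) : a <= b -> 0 <= k ->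
  absolutely_continuous_on a b f ->
  {ae @lebesgue_measure R, forall t : R, a < t < b ->
     derivable f t 1 /\ 'D_1 f t <= - k * f t} ->
  f b <= expR (- (k * (b - a))) * f a.
Proof.
move=> ab k0 fAC fae.
have gAC := absolutely_continuousM ab (@absolutely_continuous_expR k a b k0) fAC.
have dexp (t : R) : is_derive t 1 (fun s => expR (k * s)) (k * expR (k * t)).
  have d1 : is_derive t 1 (fun s : R => k * s) k.
    have -> : (fun s : R => k * s) = k \*: id by [].
    by apply: is_derive_eq; rewrite /GRing.scale/= mulr1.
  have := @is_derive1_comp _ expR (fun s => k * s) t _ _ (is_derive_expR _) d1.
  by rewrite mulrC.
have : expR (k * b) * f b <= expR (k * a) * f a.
  apply: (absolutely_continuous_nonincreasing ab gAC).
  apply: ae_mono fae => t h tab; have [fd fE] := h tab.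
  have ed : derivable (fun s => expR (k * s)) t 1 by case: (dexp t).
  split; first exact: derivableM.
  have -> : 'D_1 ((fun s => expR (k * s)) \* f) t =
      expR (k * t) *: 'D_1 f t + f t *: (k * expR (k * t)).
    by rewrite -[X in _ + f t *: X]derive_val; exact: deriveM.
  rewrite /GRing.scale/=; have := ler_wpM2l (expR_ge0 (k * t)) fE; lra.
rewrite -ler_pdivlMl ?expR_gt0// -expRN mulrA -expRD => /le_trans; apply.
by rewrite le_eqVlt; apply/orP; left; apply/eqP; congr (expR _ * _); ring.
Qed.

(** The differential inequality is available only below the level v. At the
    first time where f reaches v, Gronwall's inequality on the preceding
    interval gives f <= f a < v, a contradiction; so f stays below v for ever. *)
Lemma trapped_decay (f : R -> R) (k v a b : R) : 0 <= k ->
  (forall t, 0 <= f t) -> f a < v ->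
  absolutely_continuous_on a b f ->
  {ae @lebesgue_measure R, forall t : R, a < t < b -> f t < v ->
     derivable f t 1 /\ 'D_1 f t <= - k * f t} ->
  forall t, a <= t <= b -> f t <= expR (- (k * (t - a))) * f a.
Proof.
move=> k0 f0 fav fAC fae.
have decay c : a <= c -> c <= b -> (forall t, a < t < c -> f t < v) ->
    f c <= expR (- (k * (c - a))) * f a.
  move=> ac cb fv; apply: (gronwall ac k0).
    exact: absolutely_continuous_sub fAC.
  apply: ae_mono fae => t h tac; apply: h; last exact: fv.
  by move/andP: tac => [? ?]; apply/andP; split; lra.
have below c : a <= c -> c <= b -> f c < v.
  move=> ac cb; rewrite ltNge; apply/negP => vfc.
  pose S := [set s | a <= s <= b /\ v <= f s].
  have S_inf : has_inf S.
    split; first by exists c; rewrite /S/= ac cb.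
    by exists a => s [/andP[]].
  have aS : a <= inf S by apply: lb_le_inf; [case: S_inf|move=> s [/andP[]]].
  have Sb : inf S <= b.
    by apply: (@le_trans _ _ c) => //; apply: ge_inf; [case: S_inf|rewrite /S/= ac cb].
  have fS : f (inf S) <= expR (- (k * (inf S - a))) * f a.
    apply: decay => // t /andP[at_ tS]; rewrite ltNge; apply/negP => vft.
    suff : inf S <= t by lra.
    apply: ge_inf; first by case: S_inf.
    by split => //; apply/andP; split; lra.
  have fSa : f (inf S) <= f a.
    apply: le_trans fS _; rewrite ler_piMl// -expR0 ler_expR oppr_le0.
    by rewrite mulr_ge0// subr_ge0.
  have e0 : 0 < v - f (inf S) by lra.
  have [delta delta0 h] := absolutely_continuous_uniform fAC e0.
  have [s [sab vfs] sd] := inf_adherent delta0 S_inf.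
  have Ss : inf S <= s by apply: ge_inf; [case: S_inf|].
  have := h (inf S) s; rewrite aS Sb => /(_ isT sab).
  rewrite ger0_norm ?subr_ge0// ltrBlDl => /(_ sd).
  by move/(le_lt_trans (ler_norm _)); lra.
move=> t /andP[at_ tb]; apply: decay => // s /andP[as_ st].
by apply: below; lra.
Qed.

End AbsoluteContinuityCalculus.

(** * Equilibria of the closed loop *)

Section ClosedLoopOperators.
Variables (R : realType) (H Z U : hilbertType R).
(** D w stands for the differential of M at w and P w for B* (D w)*, the
    adjoint of D w \o B. Keeping both abstract also keeps the limits hidden in
    a differential away from unification. *)
Variables (B : {linear U -> H}) (D : H -> {linear H -> Z}) (P : H -> Z -> U).
Hypothesis pairing : forall w u z, '<[D w (B u), z]> = '<[u, P w z]>.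

(** Linearity of P w comes for free from the pairing. *)
Lemma control_linear w (a : R) y z :
  P w (a *: y + z) = a *: P w y + P w z.
Proof.
apply: inner_inj => u; rewrite [LHS]innerC [RHS]innerC.
by rewrite -pairing !innerDr !innerZr !pairing.
Qed.

Lemma controlB w y z : P w (y - z) = P w y - P w z.
Proof.
by rewrite addrC -scaleN1r control_linear scaleN1r addrC.
Qed.

Lemma control_bound (b k : R) w : 0 <= b -> 0 <= k ->
  (forall u, `|B u| <= b * `|u|) -> (forall v, `|D w v| <= k * `|v|) ->
  forall z, `|P w z| <= b * k * `|z|.
Proof.
move=> b0 k0 Bb Mk z; apply: norm_le_of_inner; last by rewrite !mulr_ge0.
rewrite -pairing; apply: le_trans (inner_le _ _) _.
rewrite mulrAC ler_wpM2r//; apply: le_trans (Mk _) _.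
by rewrite [b * k]mulrC -mulrA ler_wpM2l.
Qed.

Lemma control_lipschitz (b l : R) w w' : 0 <= b -> 0 <= l ->
  (forall u, `|B u| <= b * `|u|) ->
  (forall v, `|D w v - D w' v| <= l * `|v|) ->
  forall z, `|P w z - P w' z| <= b * l * `|z|.
Proof.
move=> b0 l0 Bb Ml z; apply: norm_le_of_inner; last by rewrite !mulr_ge0.
set q := _ - _.
have -> : '<[q, q]> = '<[D w (B q) - D w' (B q), z]>.
  by rewrite [RHS]innerBl !pairing -innerBr.
apply: le_trans (inner_le _ _) _.
rewrite mulrAC ler_wpM2r//; apply: le_trans (Ml _) _.
by rewrite [b * l]mulrC -mulrA ler_wpM2l.
Qed.

End ClosedLoopOperators.

Section Equilibrium.
Variables (R : realType) (H Z U : hilbertType R).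
Variables (DA : set H) (A : H -> H).
Variables (B : {linear U -> H}) (D : H -> {linear H -> Z}) (P : H -> Z -> U).
Variables (alpha b mu rho k l : R).
Hypothesis pairing : forall w u z, '<[D w (B u), z]> = '<[u, P w z]>.
Hypothesis A_maximal : maximal_monotone DA A.
Hypothesis A_zero : DA 0 /\ A 0 = 0.
Hypothesis alpha_gt0 : 0 < alpha.
Hypothesis A_strong : forall w1 w2, DA w1 -> DA w2 ->
  alpha * `|w1 - w2| ^+ 2 <= '<[A w1 - A w2, w1 - w2]>.
Hypotheses (b_gt0 : 0 < b) (mu_gt0 : 0 < mu) (rho_gt0 : 0 < rho)
  (k_gt0 : 0 < k) (l_gt0 : 0 < l).
Hypothesis B_bound : forall u, `|B u| <= b * `|u|.
Hypothesis dM_bound : forall w v, `|w| <= rho -> `|D w v| <= k * `|v|.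
Hypothesis dM_lip : forall w w' v, `|w| <= rho -> `|w'| <= rho ->
  `|D w v - D w' v| <= l * `|w - w'| * `|v|.
Hypothesis coercive : forall w z, `|w| <= rho ->
  mu * `|z| ^+ 2 <= `|P w z| ^+ 2.

Let PB := controlB pairing.

Lemma local_control_bound w z : `|w| <= rho -> `|P w z| <= b * k * `|z|.
Proof.
move=> w1; apply: (control_bound pairing) => //; try exact: ltW.
by move=> v; exact: dM_bound.
Qed.

Lemma local_control_lipschitz w w' z : `|w| <= rho -> `|w'| <= rho ->
  `|P w z - P w' z| <= b * (l * `|w - w'|) * `|z|.
Proof.
move=> w1 w2; apply: (control_lipschitz pairing) => //; first exact: ltW.
  by rewrite mulr_ge0// ltW.
by move=> v; exact: dM_lip.
Qed.

(** Surjectivity provides the inverse of A, strong monotonicity and the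
    Cauchy-Schwarz inequality its Lipschitz constant. *)
Lemma resolvent_exists : exists J : H -> H, forall f,
  [/\ DA (J f), A (J f) = f, alpha * `|J f| <= `|f| &
      forall g, alpha * `|J f - J g| <= `|f - g|].
Proof.
have /choice[J JP] : forall f, exists w, DA w /\ A w = f.
  have As : strongly_monotone DA A by exists alpha.
  by move=> f; have [w ? ?] := strongly_monotone_surjective A_maximal As f; exists w.
have lip w w' : DA w -> DA w' -> alpha * `|w - w'| <= `|A w - A w'|.
  move=> Dw Dw'; have [->|v0] := eqVneq (w - w') 0; first by rewrite normr0 mulr0.
  have nv : 0 < `|w - w'| by rewrite normr_gt0.
  rewrite -(ler_pM2r nv) -mulrA -expr2; apply: le_trans (A_strong Dw Dw') _.
  exact: inner_le.
exists J => f; have [DJ AJ] := JP f; split => //.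
  by have := lip _ _ DJ A_zero.1; rewrite A_zero.2 AJ !subr0.
by move=> g; have [DJg AJg] := JP g; rewrite -{2}AJ -{2}AJg; exact: lip.
Qed.

Let G w z := D w (B (P w z)).

(** For w in the ball, G w = D w \o B \o P w is coercive, so that the equation
    G w z = - y - D w d can be solved by [lax_milgram]. The solution is of
    size s, and its Lipschitz constant in w is also proportional to s, since w
    enters only through terms that multiply zeta or d. *)
Lemma gain_solution (d : H) (y : Z) (s : R) : `|d| <= s -> `|y| <= s ->
  exists zeta : H -> Z,
    [/\ forall w, `|w| <= rho -> D w (B (P w (zeta w)) + d) = - y,
        forall w, `|w| <= rho -> `|zeta w| <= (1 + k) / mu * s &
        forall w w', `|w| <= rho -> `|w'| <= rho ->
          `|zeta w - zeta w'| <=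
            l / mu * (1 + 2 * b ^+ 2 * k * ((1 + k) / mu)) * s * `|w - w'|].
Proof.
move=> ds ys.
have s0 : 0 <= s by apply: le_trans ds.
have Glin w (a : R) x z : G w (a *: x + z) = a *: G w x + G w z.
  by rewrite /G (control_linear pairing) !linearP.
have Gcoer w z : `|w| <= rho -> mu * `|z| ^+ 2 <= '<[G w z, z]>.
  by move=> w1; rewrite /G pairing inner_norm; exact: coercive.
have /choice[zeta zetaP] : forall w, exists z,
    `|w| <= rho -> G w z = - y - D w d.
  move=> w; have [w1|w1] := leP `|w| rho; last by exists 0.
  have [z zE] := lax_milgram (Glin w) mu_gt0 (fun z => Gcoer w z w1)
    (- y - D w d).
  by exists z.
have zbound w : `|w| <= rho -> `|zeta w| <= (1 + k) / mu * s.
  move=> w1; have := Gcoer _ (zeta w) w1; rewrite zetaP// => h.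
  have {}h : mu * `|zeta w| ^+ 2 <= (s + k * s) * `|zeta w|.
    apply: le_trans h _; apply: le_trans (inner_le _ _) _.
    rewrite ler_wpM2r//; apply: le_trans (ler_normB _ _) _; rewrite normrN.
    by apply: lerD => //; apply: le_trans (dM_bound _ w1) _; rewrite ler_pM2l.
  rewrite mulrAC ler_pdivlMr//.
  have [->|z0] := eqVneq (zeta w) 0.
    by rewrite normr0 mul0r mulr_ge0// addr_ge0// ltW.
  rewrite -(@ler_pM2r _ `|zeta w|) ?normr_gt0//; lra.
exists zeta; split => // [w w1|w w' w1 w1'].
  by rewrite linearD/= -/(G w (zeta w)) zetaP// subrK.
set c1 := (1 + k) / mu in zbound *.
have c10 : 0 <= c1 by rewrite divr_ge0 ?addr_ge0// ltW.
clearbody c1.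
pose x := zeta w - zeta w'.
have dMB v y1 y2 : D v (y1 - y2) = D v y1 - D v y2 by exact: linearB.
have BB u1 u2 : B (u1 - u2) = B u1 - B u2 by exact: linearB.
have zE v : `|v| <= rho -> D v (B (P v (zeta v))) = - y - D v d.
  by move=> /zetaP.
(* The difference of the equations for zeta w and zeta w'. *)
have Gx : G w x = (D w' d - D w d) + (D w' (B (P w' (zeta w')))
    - D w (B (P w' (zeta w')))) + D w (B (P w' (zeta w') - P w (zeta w'))).
  rewrite /G /x PB !BB !dMB (zE _ w1) (zE _ w1').
  move: (D w d) (D w' d) (D w (B (P w' (zeta w'))))
    (D w (B (P w (zeta w')))) => d1 d2 T1 T2.
  by apply: inner_inj => v; rewrite !innerE; ring.
have nG : `|G w x| <= l * (1 + 2 * b ^+ 2 * k * c1) * s * `|w - w'|.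
  rewrite Gx; apply: le_trans (ler_normD _ _) _.
  have t1 : `|D w' d - D w d| <= l * `|w - w'| * s.
    rewrite [`|w - w'|]distrC; apply: le_trans (dM_lip _ w1' w1) _.
    by rewrite ler_wpM2l// mulr_ge0// ltW.
  have z2 := zbound w' w1'.
  have p2 : `|B (P w' (zeta w'))| <= b * (b * k * (c1 * s)).
    apply: le_trans (B_bound _) _; rewrite ler_pM2l//.
    apply: le_trans (local_control_bound _ w1') _.
    by rewrite ler_pM2l// mulr_gt0.
  have t2 : `|D w' (B (P w' (zeta w'))) - D w (B (P w' (zeta w')))| <=
      l * `|w - w'| * (b * (b * k * (c1 * s))).
    rewrite [`|w - w'|]distrC; apply: le_trans (dM_lip _ w1' w1) _.
    by rewrite ler_wpM2l// mulr_ge0// ltW.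
  have t3 : `|D w (B (P w' (zeta w') - P w (zeta w')))| <=
      k * (b * (b * (l * `|w - w'|) * (c1 * s))).
    apply: le_trans (dM_bound _ w1) _; rewrite ler_pM2l//.
    apply: le_trans (B_bound _) _; rewrite ler_pM2l//.
    rewrite [`|w - w'|]distrC.
    apply: le_trans (local_control_lipschitz _ w1' w1) _.
    by rewrite ler_wpM2l// !mulr_ge0// ltW.
  apply: (@le_trans _ _ (l * `|w - w'| * s + l * `|w - w'| * (b * (b * k * (c1 * s)))
     + k * (b * (b * (l * `|w - w'|) * (c1 * s))))).
    by apply: lerD => //; apply: le_trans (ler_normD _ _) _; exact: lerD.
  by rewrite le_eqVlt; apply/orP; left; apply/eqP; ring.
have := Gcoer _ x w1 => h.
have {}h : mu * `|x| ^+ 2 <= l * (1 + 2 * b ^+ 2 * k * c1) * s * `|w - w'| * `|x|.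
  apply: le_trans h _; apply: le_trans (inner_le _ _) _.
  by rewrite ler_wpM2r.
rewrite -/x; have [->|x0] := eqVneq x 0.
  have c20 : 0 <= 1 + 2 * b ^+ 2 * k * c1.
    by rewrite addr_ge0// !mulr_ge0 ?exprn_ge0// ltW.
  by rewrite normr0 !mulr_ge0// ?invr_ge0// ltW.
have nx : 0 < `|x| by rewrite normr_gt0.
rewrite -(ler_pM2l mu_gt0) -(ler_pM2r nx).
apply: le_trans (_ : mu * `|x| ^+ 2 <= _); first by rewrite expr2 mulrA.
apply: le_trans h _; rewrite le_eqVlt; apply/orP; left; apply/eqP.
by field; rewrite gt_eqF.
Qed.

Lemma banach_ball (f : H -> H) :
  (forall w, `|w| <= rho -> `|f w| <= rho) ->
  (forall w w', `|w| <= rho -> `|w'| <= rho ->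
     `|f w - f w'| <= (1/2) * `|w - w'|) ->
  exists2 w, `|w| <= rho & f w = w.
Proof.
move=> frho flip.
pose S := [set w : H | `|w| <= rho].
have fS : set_fun S S f by [].
pose F : {fun S >-> S} := HB.pack f (isFun.Build _ _ S S f fS).
have [] := @banach_fixed_point R H S F.
- have h0 : 0 <= (1/2 : R) by [].
  exists (NngNum h0); split => /=; first by lra.
  by move=> [w w'] [/= Sw Sw']; exact: flip.
- have -> : S = (fun w : H => `|w|) @^-1` [set t | t <= rho] by [].
  apply: closed_comp; last exact: closed_le.
  by move=> w _; exact: norm_continuous.
- by exists 0; rewrite /S/= normr0 ltW.
by move=> w Sw wE; exists w.
Qed.

(** Eliminating the error variable with zeta leaves the fixed point equation w
    = J (B (P w (zeta w)) + d), whose right-hand side is a contraction of the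
    ball when the data are small. *)
Lemma equilibrium_exists : exists c s0 : R, [/\ 0 < c, 0 < s0 &
  forall (d : H) (y : Z) (s : R), s < s0 -> `|d| <= s -> `|y| <= s ->
  exists (w : H) (e : Z), [/\ DA w, A w = B (P w e) + d,
    D w (B (P w e) + d) = - y, `|w| <= c * s & `|e| <= c * s]].
Proof.
have [J JP] := resolvent_exists.
pose c1 := (1 + k) / mu.
pose c2 := l / mu * (1 + 2 * b ^+ 2 * k * c1).
(* c1 and c2 bound zeta and its Lipschitz constant, c3 and c4 do the same for
   the fixed point map; all are to be multiplied by s. *)
pose c3 := (b * (b * k * c1) + 1) / alpha.
pose c4 := (b * (b * k * c2 + b * l * c1)) / alpha.
have c10 : 0 < c1 by rewrite divr_gt0// addr_gt0.
have b20 : 0 < 2 * b ^+ 2 by rewrite mulr_gt0// exprn_gt0.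
have c20 : 0 < c2.
  by rewrite mulr_gt0 ?divr_gt0// addr_gt0// mulr_gt0// mulr_gt0.
have c30 : 0 < c3.
  by rewrite divr_gt0// addr_gt0// mulr_gt0// mulr_gt0// mulr_gt0.
have c40 : 0 < c4.
  by rewrite divr_gt0// mulr_gt0// addr_gt0// mulr_gt0// mulr_gt0.
have c3E : alpha * c3 = b * (b * k * c1) + 1.
  by rewrite mulrC divfK// gt_eqF.
have c4E : alpha * c4 = b * (b * k * c2 + b * l * c1).
  by rewrite mulrC divfK// gt_eqF.
clearbody c3 c4.
exists (c1 + c3), (Num.min (rho / c3) (1 / 2 / c4)); split.
- exact: addr_gt0.
- by rewrite lt_min; apply/andP; split; apply: divr_gt0 => //; exact: divr_gt0.
move=> d y s; rewrite lt_min !ltr_pdivlMr// => /andP[s1 s2] ds ys.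
have s0 : 0 <= s by apply: le_trans ds.
have [zeta [zetaP zb zlip]] := gain_solution ds ys.
pose f w := J (B (P w (zeta w)) + d).
have fb w : `|w| <= rho -> `|f w| <= c3 * s.
  move=> w1; have [_ _ h _] := JP (B (P w (zeta w)) + d).
  rewrite -(ler_pM2l alpha_gt0) mulrA c3E; apply: le_trans h _.
  apply: le_trans (ler_normD _ _) _; rewrite mulrDl mul1r; apply: lerD => //.
  have bk0 : 0 < b * k by exact: mulr_gt0.
  apply: le_trans (B_bound _) _; rewrite -[b * _ * s]mulrA ler_pM2l//.
  apply: le_trans (local_control_bound _ w1) _.
  by rewrite -[b * k * c1 * s]mulrA ler_pM2l// zb.
have [||w w1 fw] := @banach_ball f.
- by move=> w w1; apply: le_trans (fb w w1) _; rewrite ltW// mulrC.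
- move=> w w' w1 w1'.
  have [_ _ _ /(_ (B (P w' (zeta w')) + d)) h] := JP (B (P w (zeta w)) + d).
  rewrite -/(f w) -/(f w') in h.
  rewrite -(ler_pM2l alpha_gt0); apply: le_trans h _.
  rewrite opprD addrACA subrr addr0 -linearB/=.
  apply: le_trans (B_bound _) _.
  have -> : P w (zeta w) - P w' (zeta w') =
      P w (zeta w - zeta w') + (P w (zeta w') - P w' (zeta w')).
    by rewrite PB addrA subrK.
  have t1 : `|P w (zeta w - zeta w')| <= b * k * (c2 * s * `|w - w'|).
    apply: le_trans (local_control_bound _ w1) _.
    by rewrite ler_pM2l ?mulr_gt0//; exact: zlip.
  have t2 : `|P w (zeta w') - P w' (zeta w')| <= b * (l * `|w - w'|) * (c1 * s).
    apply: le_trans (local_control_lipschitz _ w1 w1') _.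
    by rewrite ler_wpM2l ?zb// !mulr_ge0// ltW.
  apply: (@le_trans _ _ (b * (b * k * (c2 * s * `|w - w'|) +
      b * (l * `|w - w'|) * (c1 * s)))).
    by rewrite ler_pM2l//; apply: le_trans (ler_normD _ _) _; exact: lerD.
  apply: (@le_trans _ _ (alpha * (s * c4) * `|w - w'|)).
    by rewrite [alpha * _]mulrCA c4E le_eqVlt; apply/orP; left; apply/eqP; ring.
  by rewrite -mulrA ler_pM2l// ler_wpM2r//; lra.
exists w, (zeta w); have [DJ AJ _ _] := JP (B (P w (zeta w)) + d).
rewrite -/(f w) fw in DJ AJ; split => //.
- exact: zetaP.
- by rewrite -{1}fw; apply: le_trans (fb w w1) _; rewrite ler_wpM2r// lerDr ltW.
- by apply: le_trans (zb w w1) _; rewrite ler_wpM2r// lerDl ltW.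
Qed.

End Equilibrium.

(** * Lyapunov functions and their rate of change *)

Section Lyapunov.
Variables (R : realType) (H Z U : hilbertType R).

Variables (A : H -> H) (B : {linear U -> H}) (D : H -> {linear H -> Z})
  (P : H -> Z -> U).
Hypothesis pairing : forall w u z, '<[D w (B u), z]> = '<[u, P w z]>.

Definition lyap (M : H -> Z) (eta : R) (w1 : H) (e1 : Z) (p : H * Z) : R :=
  eta * `|p.1 - w1| ^+ 2 + `|p.2 - M p.1 - e1| ^+ 2.

(** Half of the time derivative of [lyap] along the closed loop, in terms of w
    and of the error e = z - M w; the term C w has disappeared by the
    Sylvester equation, see [strong_solution_lyap]. *)
Definition lyap_rate (eta : R) (w1 : H) (e1 : Z) (d : H) (y : Z) (w : H) (e : Z)
    : R :=
  eta * '<[w - w1, B (P w e) + d - A w]> +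
  '<[e - e1, - y - D w (B (P w e) + d)]>.

(** Follows from |x - y|^2 <= 2 |x|^2 + 2 |y|^2. It transfers smallness from
    the Lyapunov function at the origin, whose sublevels do not depend on the
    data, to the one at an equilibrium. *)
Lemma lyap_recentre (M : H -> Z) (eta : R) (w1 : H) (e1 : Z) (p : H * Z) :
  0 < eta ->
  lyap M eta w1 e1 p <=
    2 * lyap M eta 0 0 p + 2 * (eta * `|w1| ^+ 2 + `|e1| ^+ 2).
Proof.
move=> eta0; rewrite /lyap !subr0.
have h1 := sqr_normD p.1 w1; have h2 := sqr_normB p.1 w1.
have h3 := sqr_normD (p.2 - M p.1) e1; have h4 := sqr_normB (p.2 - M p.1) e1.
have q1 : 0 <= `|p.1 + w1| ^+ 2 by rewrite exprn_ge0.
have q2 : 0 <= `|p.2 - M p.1 + e1| ^+ 2 by rewrite exprn_ge0.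
have g1 : `|p.1 - w1| ^+ 2 <= 2 * `|p.1| ^+ 2 + 2 * `|w1| ^+ 2 by lra.
have g2 := ler_wpM2l (ltW eta0) g1.
by lra.
Qed.

Lemma sqr_dist_le_lyap (M : H -> Z) (eta m : R) (w1 : H) (e1 : Z) (p : H * Z) :
  0 < eta -> `|M p.1 - M w1| <= m * `|p.1 - w1| ->
  `|p.1 - w1| ^+ 2 + `|p.2 - (e1 + M w1)| ^+ 2 <=
    ((1 + 2 * m ^+ 2) / eta + 2) * lyap M eta w1 e1 p.
Proof.
move=> eta0; rewrite /lyap.
set W := `|p.1 - w1|; set E := `|p.2 - M p.1 - e1| => Mp.
have : `|p.2 - (e1 + M w1)| <= E + m * W.
  have -> : p.2 - (e1 + M w1) = (p.2 - M p.1 - e1) + (M p.1 - M w1).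
    by apply: inner_inj => u; rewrite !innerE; ring.
  by apply: le_trans (ler_normD _ _) _; exact: lerD.
move=> /(sqr_le_of_le_add (normr_ge0 _)); set F := `|_|; move=> FE.
have clE : ((1 + 2 * m ^+ 2) / eta + 2) * (eta * W ^+ 2) =
    (1 + 2 * m ^+ 2) * W ^+ 2 + 2 * (eta * W ^+ 2).
  by field; rewrite gt_eqF.
have W2 : 0 <= eta * W ^+ 2 by rewrite mulr_ge0 ?sqr_ge0// ltW.
have E2 : 2 * E ^+ 2 <= ((1 + 2 * m ^+ 2) / eta + 2) * E ^+ 2.
  rewrite ler_wpM2r ?sqr_ge0// lerDr divr_ge0// ?(ltW eta0)//.
  by rewrite addr_ge0// mulr_ge0// sqr_ge0.
by rewrite mulrDr clE; lra.
Qed.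

Lemma lyap_le_sqr_dist (M : H -> Z) (eta m : R) (w1 : H) (e1 : Z) (p : H * Z) :
  0 < eta -> `|M p.1 - M w1| <= m * `|p.1 - w1| ->
  lyap M eta w1 e1 p <= (eta + 2 * m ^+ 2 + 2) *
    (`|p.1 - w1| ^+ 2 + `|p.2 - (e1 + M w1)| ^+ 2).
Proof.
move=> eta0; rewrite /lyap.
set W := `|p.1 - w1|; set F := `|p.2 - (e1 + M w1)| => Mp.
have : `|p.2 - M p.1 - e1| <= F + m * W.
  have -> : p.2 - M p.1 - e1 = (p.2 - (e1 + M w1)) - (M p.1 - M w1).
    by apply: inner_inj => u; rewrite !innerE; ring.
  by apply: le_trans (ler_normB _ _) _; exact: lerD.
move=> /(sqr_le_of_le_add (normr_ge0 _)); set E := `|_|; move=> EF.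
have W2 : 0 <= W ^+ 2 by rewrite sqr_ge0.
have F2 : 0 <= F ^+ 2 by rewrite sqr_ge0.
have g1 : 0 <= eta * F ^+ 2 by rewrite mulr_ge0// ltW.
have g2 : 0 <= m ^+ 2 * F ^+ 2 by rewrite mulr_ge0// sqr_ge0.
by lra.
Qed.

(** Subtract the equilibrium relations and split B (P w e) + d - (B (P w1 e1)
    + d) into B q + B p, with q = P w (e - e1) and p = (P w - P w1) e1.
    Coercivity makes the term with q in the error equation dissipative, strong
    monotonicity does the same for w, and p is small because e1 is. The
    coupling of w to q is absorbed by choosing eta small; all other cross
    terms carry the factor s. *)
Lemma local_lyap_rate (alpha b mu k l s eta kappa : R) (d : H) (y : Z)
    (w w1 : H) (e e1 : Z) :
  0 < alpha -> 0 < b -> 0 < mu -> 0 < k -> 0 < l -> 0 < eta -> 0 < kappa ->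
  (forall u, `|B u| <= b * `|u|) ->
  (forall v, `|D w v| <= k * `|v|) ->
  (forall z, `|P w z| <= b * k * `|z|) ->
  (forall z, `|P w1 z| <= b * k * `|z|) ->
  (forall v, `|D w v - D w1 v| <= l * `|w - w1| * `|v|) ->
  (forall z, `|P w z - P w1 z| <= b * (l * `|w - w1|) * `|z|) ->
  (forall z, mu * `|z| ^+ 2 <= `|P w z| ^+ 2) ->
  alpha * `|w - w1| ^+ 2 <= '<[A w - A w1, w - w1]> ->
  A w1 = B (P w1 e1) + d -> D w1 (B (P w1 e1) + d) = - y ->
  `|d| <= s -> `|e1| <= s ->
  b ^+ 2 * l * s <= alpha / 4 ->
  eta * (b ^+ 2 * k) ^+ 2 <= alpha * mu / 4 ->
  (l * (2 * b ^+ 2 * k + 1) * s) ^+ 2 <= eta * alpha * mu / 4 ->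
  kappa <= alpha / 4 -> kappa <= mu / 2 ->
  lyap_rate eta w1 e1 d y w e <=
    - kappa * (eta * `|w - w1| ^+ 2 + `|e - e1| ^+ 2).
Proof.
move=> alpha0 b0 mu0 k0 l0 eta0 kappa0 Bb Dk Pk P1k Dl Pl Pmu Amono A1 D1 ds es
  c1 c2 c3 ka km.
have s0 : 0 <= s by apply: le_trans ds.
set W := `|w - w1| in Dl Pl Amono *; set E := `|e - e1|.
have W0 : 0 <= W by exact: normr_ge0.
have E0 : 0 <= E by exact: normr_ge0.
pose q := P w (e - e1); pose p := P w e1 - P w1 e1.
pose a1 := B (P w1 e1) + d; rewrite -/a1 in A1 D1.
(* Splitting relative to the equilibrium, where B (P w1 e1) + d = A w1 =: a1. *)
have aE : B (P w e) + d = a1 + (B q + B p).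
  rewrite /a1 /q /p (controlB pairing) -linearD/= addrA subrK linearB/=.
  by rewrite [B (P w e) - _]addrC addrACA subrr add0r addrC.
have qb : `|q| <= b * k * E by exact: Pk.
have pb : `|p| <= b * (l * W) * s.
  apply: le_trans (Pl _) _; rewrite ler_wpM2l//.
  by rewrite !mulr_ge0// ltW.
have a1b : `|a1| <= (b ^+ 2 * k + 1) * s.
  apply: le_trans (ler_normD _ _) _; rewrite mulrDl mul1r; apply: lerD => //.
  apply: le_trans (Bb _) _; rewrite expr2 -!mulrA ler_pM2l//.
  apply: le_trans (P1k _) _; rewrite -!mulrA !ler_pM2l//.
clearbody a1.
have Bq : `|B q| <= b * (b * k * E).
  by apply: le_trans (Bb _) _; rewrite ler_pM2l.
have Bp : `|B p| <= b * (b * (l * W) * s).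
  by apply: le_trans (Bb _) _; rewrite ler_pM2l.
have t1 : '<[w - w1, B q + B p]> <= W * (b * (b * k * E) + b * (b * (l * W) * s)).
  apply: le_trans (inner_le _ _) _; rewrite ler_wpM2l//.
  by apply: le_trans (ler_normD _ _) _; exact: lerD.
have t2 : mu * E ^+ 2 <= '<[e - e1, D w (B q)]>.
  by rewrite innerC pairing inner_norm; exact: Pmu.
have t3 : - (E * (k * (b * (b * (l * W) * s)))) <= '<[e - e1, D w (B p)]>.
  apply: le_trans (inner_ge _ _); rewrite lerN2 ler_wpM2l//.
  by apply: le_trans (Dk _) _; rewrite ler_pM2l.
have t4 : - (E * (l * W * ((b ^+ 2 * k + 1) * s))) <=
    '<[e - e1, D w a1 - D w1 a1]>.
  apply: le_trans (inner_ge _ _); rewrite lerN2 ler_wpM2l//.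
  apply: le_trans (Dl _) _; rewrite ler_wpM2l//.
  by rewrite mulr_ge0// ltW.
clearbody p q.
have rateE : lyap_rate eta w1 e1 d y w e =
  eta * ('<[w - w1, B q + B p]> - '<[A w - A w1, w - w1]>) -
  ('<[e - e1, D w (B q)]> + '<[e - e1, D w (B p)]> +
   '<[e - e1, D w a1 - D w1 a1]>).
  rewrite /lyap_rate aE -D1 A1 !linearD/= (innerC (A w - a1)).
  congr (_ * _ + _).
    by rewrite -innerBr; congr inner; rewrite opprB [RHS]addrCA [RHS]addrA.
  by rewrite !(innerDr, innerNr); ring.
rewrite rateE.
have y1 : eta * (b ^+ 2 * k) * W * E <= eta * alpha / 4 * W ^+ 2 + mu / 4 * E ^+ 2.
  apply: young; first by rewrite divr_gt0// mulr_gt0.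
  by have := ler_wpM2l (ltW eta0) c2; lra.
have y2 : l * (2 * b ^+ 2 * k + 1) * s * W * E <=
    eta * alpha / 4 * W ^+ 2 + mu / 4 * E ^+ 2.
  apply: young; first by rewrite divr_gt0// mulr_gt0.
  apply: le_trans c3 _.
  by rewrite le_eqVlt; apply/orP; left; apply/eqP; field.
have W2 : 0 <= eta * W ^+ 2 by rewrite mulr_ge0 ?sqr_ge0// ltW.
have E2 : 0 <= E ^+ 2 by rewrite sqr_ge0.
have m1 := ler_wpM2l (ltW eta0) t1.
have m2 := ler_wpM2l (ltW eta0) Amono.
have m3 := ler_wpM2r W2 c1.
have m4 := ler_wpM2r W2 ka.
have m5 := ler_wpM2r E2 km.
lra.
Qed.

(** Here D w and P w may grow with w, so the coupling term eta * <w, B (P w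
    e)> must not be estimated by |e|: it is absorbed by the dissipation |P w
    e|^2 of the error equation, half of which still controls |e|^2. The data
    contribute a constant of order s^2. *)
Lemma global_lyap_rate (alpha b lambda k l s eta kappa : R) (d : H) (y : Z)
    (w : H) (e : Z) :
  0 < alpha -> 0 < b -> 0 < lambda -> 0 < k -> 0 < l -> 0 < eta -> 0 < kappa ->
  (forall u, `|B u| <= b * `|u|) ->
  `|D w d| <= (k + l * `|w|) * `|d| ->
  lambda * `|e| ^+ 2 <= `|P w e| ^+ 2 ->
  alpha * `|w| ^+ 2 <= '<[A w, w]> ->
  `|d| <= s -> `|y| <= s ->
  eta * b ^+ 2 <= alpha / 2 ->
  (l * s) ^+ 2 <= eta * alpha * lambda / 16 ->
  kappa <= alpha / 2 -> kappa <= lambda / 4 ->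
  lyap_rate eta 0 0 d y w e <=
    - kappa * (eta * `|w| ^+ 2 + `|e| ^+ 2) +
    (2 * eta / alpha + 2 * (1 + k) ^+ 2 / lambda) * s ^+ 2.
Proof.
move=> alpha0 b0 lambda0 k0 l0 eta0 kappa0 Bb Dd Pl Amono ds ys c1 c2 ka kl.
have s0 : 0 <= s by apply: le_trans ds.
set W := `|w| in Dd Amono *; set E := `|e| in Pl *.
have W0 : 0 <= W by exact: normr_ge0.
have E0 : 0 <= E by exact: normr_ge0.
set Q := `|P w e| in Pl.
have t1 : '<[w, B (P w e)]> <= W * (b * Q).
  by apply: le_trans (inner_le _ _) _; rewrite ler_wpM2l.
have t2 : '<[w, d]> <= W * s.
  by apply: le_trans (inner_le _ _) _; rewrite ler_wpM2l.
have t3 : '<[e, - y]> <= E * s.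
  by apply: le_trans (inner_le _ _) _; rewrite normrN ler_wpM2l.
have t4 : '<[e, - D w d]> <= E * ((k + l * W) * s).
  apply: le_trans (inner_le _ _) _; rewrite normrN ler_wpM2l//.
  apply: le_trans Dd _; rewrite ler_wpM2l// addr_ge0// ?mulr_ge0// ltW//.
have rateE : lyap_rate eta 0 0 d y w e =
  eta * ('<[w, B (P w e)]> + '<[w, d]> - '<[A w, w]>) +
  ('<[e, - y]> - Q ^+ 2 + '<[e, - D w d]>).
  rewrite /lyap_rate !subr0 linearD/= opprD addrA !innerDr !innerNr.
  by rewrite (innerC e (D w (B _))) pairing inner_norm (innerC w (A w)).
rewrite rateE.
have y1 : eta * b * W * Q <= eta * alpha / 4 * W ^+ 2 + 1 / 2 * Q ^+ 2.
  apply: young; first by rewrite divr_gt0// mulr_gt0.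
  by have := ler_wpM2l (ltW eta0) c1; lra.
have y2 : eta * W * s <= eta * alpha / 8 * W ^+ 2 + 2 * eta / alpha * s ^+ 2.
  apply: young; first by rewrite divr_gt0// mulr_gt0.
  by rewrite le_eqVlt; apply/orP; left; apply/eqP; field; rewrite gt_eqF.
have y3 : (1 + k) * E * s <= lambda / 8 * E ^+ 2 + 2 * (1 + k) ^+ 2 / lambda * s ^+ 2.
  apply: young; first by rewrite divr_gt0.
  by rewrite le_eqVlt; apply/orP; left; apply/eqP; field; rewrite gt_eqF.
have y4 : l * s * W * E <= eta * alpha / 8 * W ^+ 2 + lambda / 8 * E ^+ 2.
  apply: young; first by rewrite divr_gt0// mulr_gt0.
  apply: le_trans c2 _.
  by rewrite le_eqVlt; apply/orP; left; apply/eqP; field.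
have W2 : 0 <= eta * W ^+ 2 by rewrite mulr_ge0 ?sqr_ge0// ltW.
have E2 : 0 <= E ^+ 2 by rewrite sqr_ge0.
have m1 := ler_wpM2l (ltW eta0) t1.
have m2 := ler_wpM2l (ltW eta0) t2.
have m3 := ler_wpM2l (ltW eta0) Amono.
have m4 := ler_wpM2r W2 ka.
have m5 := ler_wpM2r E2 kl.
move: y2 y3; set cs := 2 * eta / alpha; set ct := 2 * (1 + k) ^+ 2 / lambda => y2 y3.
lra.
Qed.

End Lyapunov.

(** * Decay along strong and weak solutions *)

Section LyapunovAlongSolutions.
Variables (R : realType) (H Z U : hilbertType R).
Variables (DA : set H) (A : H -> H) (B : {linear U -> H}) (C : H -> Z)
  (M : H -> Z) (D : H -> {linear H -> Z}) (P : H -> Z -> U).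
Hypothesis M_differentiable : forall w, differentiable M w.
Hypothesis dME : forall w v, 'd M w v = D w v.
Hypothesis feedbackE : forall w z, feedback B M w z = B (P w (z - M w)).
Hypothesis sylvester : forall w, DA w -> D w (A w) + C w = 0.
Hypothesis M_lipschitz : forall rho : R, exists2 k : R, 0 < k &
  forall w w', `|w| <= rho -> `|w'| <= rho -> `|M w - M w'| <= k * `|w - w'|.

Variables (eta : R) (w1 : H) (e1 : Z).
Hypothesis eta_gt0 : 0 < eta.
Let V := lyap M eta w1 e1.

(** A trajectory on a compact interval is bounded, and [lyap] is Lipschitz on
    bounded sets because M is. *)
Lemma absolutely_continuous_lyap (T : R) (x : R -> H * Z) : 0 <= T ->
  absolutely_continuous_on 0 T x -> absolutely_continuous_on 0 T (V \o x).
Proof.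
move=> T0 xAC; have [kx kx0 xk] := absolutely_continuous_bounded xAC T0.
have [k k0 Mk] := M_lipschitz kx.
pose kw := kx + `|w1|; pose ke := kx + (k * kx + `|M 0|) + `|e1|.
have fst_le (p : H * Z) : `|p.1| <= `|p| by rewrite [leRHS]prod_normE le_max lexx.
have snd_le (p : H * Z) : `|p.2| <= `|p|.
  by rewrite [leRHS]prod_normE le_max lexx orbT.
apply: (absolutely_continuous_dominated
  (L := eta * (2 * kw) + 2 * ke * (1 + k)) xAC) => s t /xk xs /xk xt.
have ws : `|(x s).1| <= kx by apply: le_trans xs.
have wt : `|(x t).1| <= kx by apply: le_trans xt.
have zs : `|(x s).2| <= kx by apply: le_trans xs.
have zt : `|(x t).2| <= kx by apply: le_trans xt.
have dw : `|(x t).1 - (x s).1| <= `|x t - x s| by exact: (fst_le (x t - x s)).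
have dz : `|(x t).2 - (x s).2| <= `|x t - x s| by exact: (snd_le (x t - x s)).
have wb (w : H) : `|w| <= kx -> `|w - w1| <= kw.
  by move=> h; apply: le_trans (ler_normB _ _) _; rewrite lerD2r.
have eb (w : H) (z : Z) : `|w| <= kx -> `|z| <= kx -> `|z - M w - e1| <= ke.
  move=> hw hz; apply: le_trans (ler_normB _ _) _; rewrite lerD2r.
  apply: le_trans (ler_normB _ _) _; apply: lerD => //.
  have -> : M w = (M w - M 0) + M 0 by rewrite subrK.
  apply: le_trans (ler_normD _ _) _; rewrite lerD2r.
  apply: le_trans (Mk _ _ hw _) _; first by rewrite normr0 ltW.
  by rewrite subr0 ler_pM2l.
have i1 := sqr_norm_lipschitz (wb _ wt) (wb _ ws).
have i2 := sqr_norm_lipschitz (eb _ _ wt zt) (eb _ _ ws zs).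
rewrite /V /lyap /= opprD addrACA -mulrBr.
apply: le_trans (ler_normD _ _) _; rewrite normrM (gtr0_norm eta_gt0) mulrDl.
have kw0 : 0 <= 2 * kw by rewrite mulr_ge0// addr_ge0// ltW.
have ke0 : 0 <= 2 * ke.
  by rewrite mulr_ge0// addr_ge0// addr_ge0 ?(ltW kx0)// addr_ge0// mulr_ge0// ltW.
apply: lerD.
  rewrite -mulrA ler_pM2l//; apply: le_trans i1 _; rewrite ler_wpM2l//.
  by rewrite opprB addrA subrK.
rewrite -mulrA; apply: le_trans i2 _; rewrite ler_wpM2l//.
have -> : (x t).2 - M (x t).1 - e1 - ((x s).2 - M (x s).1 - e1) =
    ((x t).2 - (x s).2) - (M (x t).1 - M (x s).1).
  by apply: inner_inj => v; rewrite !innerE; ring.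
apply: le_trans (ler_normB _ _) _; rewrite mulrDl mul1r; apply: lerD => //.
by apply: le_trans (Mk _ _ wt ws) _; rewrite ler_pM2l.
Qed.

Lemma is_derive_lyap (w : R -> H) (z : R -> Z) (t : R) (dw : H) (dz : Z) :
  is_derive t 1 w dw -> is_derive t 1 z dz ->
  is_derive t 1 (fun s => V (w s, z s))
    (2 * (eta * '<[w t - w1, dw]> +
          '<[z t - M (w t) - e1, dz - D (w t) dw]>)).
Proof.
move=> hw hz.
have hM := is_derive_comp_diff (M_differentiable (w t)) hw.
rewrite dME in hM.
have h1 : is_derive t 1 (fun s => w s - w1) dw.
  by rewrite -[dw]subr0; apply: is_deriveB.
have h2 : is_derive t 1 (fun s => z s - M (w s) - e1) (dz - D (w t) dw).
  rewrite -[_ - D _ _]subr0; apply: is_deriveB; exact: is_deriveB.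
have n1 := is_derive_sqr_norm h1; have n2 := is_derive_sqr_norm h2.
have n3 : is_derive t 1 (fun s => eta *: (`|w s - w1| ^+ 2 : R))
  (eta *: (2 * '<[w t - w1, dw]>)) by exact: is_deriveZ.
have dV := is_deriveD n3 n2; apply: (is_derive_eq dV).
by rewrite /GRing.scale/=; ring.
Qed.

(** With a = B (P w e) + d, the derivative of z - M w is C w - y - D w (a - A
    w) = - y - D w a: the Sylvester equation cancels C w against D w (A w). *)
Lemma strong_solution_lyap (d : H) (y : Z) (T : R) (x : R -> H * Z) :
  strong_solution DA A B C M d y T x ->
  {ae @lebesgue_measure R, forall t : R, 0 < t < T ->
    DA (x t).1 /\
    is_derive t 1 (V \o x)
      (2 * lyap_rate A B D P eta w1 e1 d y (x t).1 ((x t).2 - M (x t).1))}.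
Proof.
move=> [_ xDA xae]; apply: ae_mono xae => t h t0T.
have DAx : DA (x t).1 by apply: xDA; move/andP: t0T => [? ?]; rewrite !ltW.
split => //; have [wd wE zd zE] := h t0T.
have -> : V \o x = (fun s => V ((x s).1, (x s).2)).
  by apply/funext => s /=; case: (x s).
have hw : is_derive t 1 (fun s => (x s).1) ('D_1 (fun s => (x s).1) t) by [].
have hz : is_derive t 1 (fun s => (x s).2) ('D_1 (fun s => (x s).2) t) by [].
apply: (is_derive_eq (is_derive_lyap hw hz)); congr (2 * _).
move: wE; rewrite feedbackE zE; set a := B _ + d => wE.
have -> : 'D_1 (fun s => (x s).1) t = a - A (x t).1 by rewrite -wE addrK.
rewrite /lyap_rate -/a; congr (_ + '<[_, _]>).
have -> : C (x t).1 = - D (x t).1 (A (x t).1).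
  by apply/eqP; rewrite -addr_eq0 addrC sylvester.
rewrite linearB/=; move: (D _ (A _)) (D _ a) => p q.
by apply: inner_inj => v; rewrite !innerE; ring.
Qed.

Lemma strong_trapped_decay (d : H) (y : Z) (T v kappa : R) (x : R -> H * Z) :
  0 < kappa ->
  (forall w z, DA w -> V (w, z) < v ->
     lyap_rate A B D P eta w1 e1 d y w (z - M w) <= - kappa * V (w, z)) ->
  strong_solution DA A B C M d y T x ->
  forall s t, 0 <= s -> s <= t -> t <= T -> V (x s) < v ->
    V (x t) <= expR (- (2 * kappa * (t - s))) * V (x s).
Proof.
move=> kappa0 rate xstr s t s0 st tT Vs.
have [xAC _ _] := xstr.
have VAC := absolutely_continuous_lyap (le_trans s0 (le_trans st tT)) xAC.
apply: (@trapped_decay _ (V \o x) (2 * kappa) v s t) => //.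
- by rewrite mulr_ge0// ltW.
- by move=> r; rewrite /V /lyap/= addr_ge0 ?mulr_ge0 ?sqr_ge0// ltW.
- exact: absolutely_continuous_sub VAC.
- apply: ae_mono (strong_solution_lyap xstr) => r h /andP[sr rt] Vr.
  have [|DAr [dr ->]] := h; first by apply/andP; split; lra.
  split => //; have := rate (x r).1 (x r).2 DAr; rewrite -surjective_pairing.
  by move=> /(_ Vr) /=; lra.
- by rewrite st lexx.
Qed.

(** Gronwall's inequality for V - c / kappa. *)
Lemma strong_global_decay (d : H) (y : Z) (T c kappa : R) (x : R -> H * Z) :
  0 < kappa -> 0 <= c ->
  (forall w z, DA w ->
     lyap_rate A B D P eta w1 e1 d y w (z - M w) <= - kappa * V (w, z) + c) ->
  strong_solution DA A B C M d y T x ->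
  forall t, 0 <= t <= T ->
    V (x t) <= expR (- (2 * kappa * t)) * V (x 0) + c / kappa.
Proof.
move=> kappa0 c0 rate xstr t /andP[t0 tT].
have [xAC _ _] := xstr.
have VAC := absolutely_continuous_lyap (le_trans t0 tT) xAC.
(* c / kappa is the level at which the bound on the rate vanishes. *)
pose f r := V (x r) - c / kappa.
have fAC : absolutely_continuous_on 0 t f.
  apply: (absolutely_continuous_dominated (L := 1) (x := V \o x)).
    exact: absolutely_continuous_sub VAC.
  by move=> r r' _ _; rewrite /f mul1r opprB addrA subrK.
have ck : c / kappa * kappa = c by rewrite divfK// gt_eqF.
have ck0 : 0 <= c / kappa by rewrite divr_ge0// ltW.
have : f t <= expR (- (2 * kappa * (t - 0))) * f 0.
  apply: gronwall => //; first by rewrite mulr_ge0// ltW.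
  apply: ae_mono (strong_solution_lyap xstr) => r h /andP[sr rt].
  have [|DAr dr] := h; first by apply/andP; split; lra.
  have df : is_derive r 1 f
    (2 * lyap_rate A B D P eta w1 e1 d y (x r).1 ((x r).2 - M (x r).1)).
    rewrite -[X in is_derive _ _ _ X]subr0; exact: is_deriveB.
  case: df => df ->; split => //.
  have := rate (x r).1 (x r).2 DAr; rewrite -surjective_pairing /f.
  by move: ck; set q := c / kappa => ck; lra.
rewrite subr0 /f; have := expR_ge0 (- (2 * kappa * t)).
move: ck0; set q := c / kappa; set ee := expR _ => q0 ee0.
by have := mulr_ge0 ee0 q0; lra.
Qed.

Hypothesis M_continuous : continuous M.

Lemma cvg_lyap (T : Type) (F : set_system T) (FF : Filter F)
  (xn : T -> H * Z) (p : H * Z) : xn @ F --> p -> (fun n => V (xn n)) @ F --> V p.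
Proof.
move=> xp.
have c1 : (fun n => (xn n).1) @ F --> p.1 by apply: cvg_comp xp _; exact: cvg_fst.
have c2 : (fun n => (xn n).2) @ F --> p.2 by apply: cvg_comp xp _; exact: cvg_snd.
apply: cvgD.
  by apply: cvgMr; apply: cvg_sqr_norm; apply: cvgB => //; exact: cvg_cst.
apply: cvg_sqr_norm; apply: cvgB; last exact: cvg_cst.
by apply: cvgB => //; apply: cvg_comp c1 _; exact: M_continuous.
Qed.

Lemma weak_cvg_lyap (T : R) (xn : nat -> R -> H * Z) (x : R -> H * Z) :
  {uniform `[0, T]%classic, xn @ \oo --> x} ->
  forall r, 0 <= r <= T -> (fun n => V (xn n r)) @ \oo --> V (x r).
Proof.
move=> xnx r rT; apply: cvg_lyap.
have sub : [set r] `<=` `[0, T]%classic by move=> _ ->; rewrite /= in_itv.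
have := uniform_subset_cvg (F := xn @ \oo) _ sub xnx.
rewrite uniform_set1 => h; exact: h.
Qed.

(** The estimate passes to uniform limits because the strong solutions that
    approximate x are eventually below the level v at time s. *)
Lemma weak_trapped_decay (d : H) (y : Z) (v kappa : R) (x : R -> H * Z) :
  0 < kappa ->
  (forall w z, DA w -> V (w, z) < v ->
     lyap_rate A B D P eta w1 e1 d y w (z - M w) <= - kappa * V (w, z)) ->
  weak_solution DA A B C M d y x ->
  forall s t, 0 <= s -> s <= t -> V (x s) < v ->
    V (x t) <= expR (- (2 * kappa * (t - s))) * V (x s).
Proof.
move=> kappa0 rate xw s t s0 st Vs.
have T0 : 0 < t + 1 by lra.
have [xn [xnstr xnx]] := xw _ T0.
have pt := weak_cvg_lyap xnx.
have cs := pt s; have ct := pt t.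
apply: (ler_cvg_to (f := fun n => V (xn n t))
  (g := fun n => expR (- (2 * kappa * (t - s))) * V (xn n s)) (a := \oo)).
- by apply: ct; apply/andP; split; lra.
- by apply: cvgMr; apply: cs; apply/andP; split; lra.
have /cvgrPdist_lt /(_ (v - V (x s))) : (fun n => V (xn n s)) @ \oo --> V (x s).
  by apply: cs; apply/andP; split; lra.
rewrite subr_gt0 => /(_ Vs); apply: filterS => n; rewrite ltr_norml => /andP[h1 h2].
apply: (strong_trapped_decay kappa0 rate (xnstr n)) => //; lra.
Qed.

Lemma weak_global_decay (d : H) (y : Z) (c kappa : R) (x : R -> H * Z) :
  0 < kappa -> 0 <= c ->
  (forall w z, DA w ->
     lyap_rate A B D P eta w1 e1 d y w (z - M w) <= - kappa * V (w, z) + c) ->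
  weak_solution DA A B C M d y x ->
  forall t, 0 <= t -> V (x t) <= expR (- (2 * kappa * t)) * V (x 0) + c / kappa.
Proof.
move=> kappa0 c0 rate xw t t0.
have T0 : 0 < t + 1 by lra.
have [xn [xnstr xnx]] := xw _ T0.
have pt := weak_cvg_lyap xnx.
apply: (ler_cvg_to (f := fun n => V (xn n t))
  (g := fun n => expR (- (2 * kappa * t)) * V (xn n 0) + c / kappa) (a := \oo)).
- by apply: pt; apply/andP; split; lra.
- apply: cvgD; last exact: cvg_cst.
  by apply: cvgMr; apply: pt; apply/andP; split; lra.
apply: nearW => n; apply: (strong_global_decay kappa0 c0 rate (xnstr n)).
by apply/andP; split; lra.
Qed.

End LyapunovAlongSolutions.

(** * Local exponential and global asymptotic stability *)

Section Stabilization.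
Variables (R : realType) (H Z U : hilbertType R).

Variables (DA : set H) (A : H -> H) (B : {linear U -> H}) (C : H -> Z)
  (M : H -> Z) (D : H -> {linear H -> Z}) (P : H -> Z -> U).
Variables (alpha b k0 l lambda : R) (adm : R -> set (H * Z)).
Hypothesis M_differentiable : forall w, differentiable M w.
Hypothesis dME : forall w v, 'd M w v = D w v.
Hypothesis pairing : forall w u z, '<[D w (B u), z]> = '<[u, P w z]>.
Hypothesis feedbackE : forall w z, feedback B M w z = B (P w (z - M w)).
Hypothesis sylvester : forall w, DA w -> D w (A w) + C w = 0.
Hypothesis M_lipschitz : forall rho : R, exists2 k : R, 0 < k &
  forall w w', `|w| <= rho -> `|w'| <= rho -> `|M w - M w'| <= k * `|w - w'|.
Hypothesis M_zero : M 0 = 0.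
Hypothesis A_maximal : maximal_monotone DA A.
Hypothesis A_zero : DA 0 /\ A 0 = 0.
Hypothesis A_strong : forall w1 w2, DA w1 -> DA w2 ->
  alpha * `|w1 - w2| ^+ 2 <= '<[A w1 - A w2, w1 - w2]>.
Hypotheses (alpha_gt0 : 0 < alpha) (b_gt0 : 0 < b) (k0_gt0 : 0 < k0)
  (l_gt0 : 0 < l) (lambda_gt0 : 0 < lambda).
Hypothesis B_bound : forall u, `|B u| <= b * `|u|.
Hypothesis D0_bound : forall v, `|D 0 v| <= k0 * `|v|.
Hypothesis D_lip : forall w w' v, `|w| <= 1 -> `|w'| <= 1 ->
  `|D w v - D w' v| <= l * `|w - w'| * `|v|.
Hypothesis P0_coercive : forall z, lambda * `|z| ^+ 2 <= `|P 0 z| ^+ 2.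
Hypothesis adm_small : forall r d y, adm r (d, y) -> `|d| <= r /\ `|y| <= r.
Hypothesis adm_growth : forall r d y w, adm r (d, y) ->
  `|D w d| <= (k0 + l * `|w|) * `|d|.

(** Near the origin P w is a small perturbation of P 0, so it keeps half of
    the lower bound sqrt lambda, hence the quarter of lambda. *)
Lemma small_ball_constants : exists k mu rho : R,
  [/\ [/\ 0 < k, k0 <= k, 0 < mu & mu = lambda / 4], 0 < rho, rho <= 1,
    forall w v, `|w| <= rho -> `|D w v| <= k * `|v| &
    forall w z, `|w| <= rho -> mu * `|z| ^+ 2 <= `|P w z| ^+ 2].
Proof.
pose sl := Num.sqrt lambda.
have sl0 : 0 < sl by rewrite sqrtr_gt0.
have slE : sl ^+ 2 = lambda by rewrite sqr_sqrtr// ltW.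
pose rho := Num.min 1 (sl / (2 * b * l)).
have rho1 : rho <= 1 by rewrite ge_min lexx.
exists (k0 + l), (lambda / 4), rho; split => //.
- by split => //; rewrite ?divr_gt0 ?addr_gt0// lerDl ltW.
- by rewrite lt_min ltr01 divr_gt0// !mulr_gt0.
- move=> w v w1; have -> : D w v = D 0 v + (D w v - D 0 v) by rewrite addrC subrK.
  apply: le_trans (ler_normD _ _) _; rewrite mulrDl; apply: lerD => //.
  have w1' := le_trans w1 rho1.
  apply: le_trans (D_lip _ w1' _) _; first by rewrite normr0.
  by rewrite subr0 ler_wpM2r// ler_piMr// ltW.
move=> w z w1.
have p0 : sl * `|z| <= `|P 0 z|.
  rewrite -(ler_pXn2r (n := 2)) ?nnegrE ?mulr_ge0// ?(ltW sl0)//.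
  by rewrite exprMn slE.
have dp : `|P w z - P 0 z| <= sl / 2 * `|z|.
  have w1' := le_trans w1 rho1.
  have lw : forall v, `|D w v - D 0 v| <= l * `|w| * `|v|.
    by move=> v; rewrite -{2}[w]subr0; apply: D_lip; rewrite ?normr0.
  apply: le_trans (control_lipschitz pairing (ltW b_gt0) _ B_bound lw z) _.
    by rewrite mulr_ge0// ltW.
  rewrite ler_wpM2r//.
  have : `|w| <= sl / (2 * b * l).
    by apply: le_trans w1 _; rewrite ge_min lexx orbT.
  by rewrite ler_pdivlMr ?mulr_gt0//; lra.
have : sl / 2 * `|z| <= `|P w z|.
  have := ler_normB (P w z) (P w z - P 0 z); rewrite opprB addrC subrK.
  by lra.
rewrite -(ler_pXn2r (n := 2)) ?nnegrE// ?mulr_ge0// ?divr_ge0// ?(ltW sl0)//.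
by rewrite !exprMn slE; apply: le_trans; rewrite exprVn; lra.
Qed.

(** The neighbourhood N is the sublevel {V0 < v / 8} of the Lyapunov function
    V0 centred at the origin. It is independent of the data, while decay is
    measured by V1, centred at the equilibrium, and holds in {V1 < v};
    [lyap_recentre] and the smallness of the equilibrium give {V0 < v / 4}
    included in {V1 < v}. For the global statement, V0 decreases exponentially
    up to a constant less than v / 8, so that every trajectory enters {V0 < v
    / 4} after a finite time T0, from where the local estimate takes over. *)
Theorem stabilization :
  exists (K kappa r : R) (N : set (H * Z)),
    [/\ 0 < K, 0 < kappa, 0 < r, nbhs (0 : H * Z) N &
      forall (d : H) (yref : Z), adm r (d, yref) ->
        exists xstar : H * Z,
          [/\ equilibrium DA A B C M d yref xstar,
              N xstar,
              C xstar.1 = yref,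
              (forall (x0 : H * Z) (x : R -> H * Z), N x0 ->
                 weak_solution DA A B C M d yref x -> x 0 = x0 ->
                 forall t : R, 0 <= t ->
                   hnorm (x t - xstar) <=
                     K * expR (- (kappa * t)) * hnorm (x0 - xstar)) &
              ((forall (w : H) (z : Z),
                  lambda * `|z| ^+ 2 <= `|P w z| ^+ 2) ->
               forall (x0 : H * Z) (x : R -> H * Z),
                 weak_solution DA A B C M d yref x -> x 0 = x0 ->
                 x t @[t --> +oo] --> xstar)]].
Proof.
have [k [mu [rho [[k_gt0 k0k mu0 muE] rho0 rho_le1 ub sc]]]] :=
  small_ball_constants.
have [m m0 Mm] := M_lipschitz rho.
have [c [s0 [c0 s00 eqE]]] := equilibrium_exists pairing A_maximal A_zero
  alpha_gt0 A_strong b_gt0 mu0 rho0 k_gt0 l_gt0 B_bound ub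
  (fun w w' v h h' => D_lip v (le_trans h rho_le1) (le_trans h' rho_le1))
  sc.
have Pb w z : `|w| <= rho -> `|P w z| <= b * k * `|z|.
  move=> w1; apply: (control_bound pairing) => //; try exact: ltW.
  by move=> v; exact: ub.
have Pl w w' z : `|w| <= rho -> `|w'| <= rho ->
    `|P w z - P w' z| <= b * (l * `|w - w'|) * `|z|.
  move=> w1 w1'; apply: (control_lipschitz pairing) => //; first exact: ltW.
    by rewrite mulr_ge0// ltW.
  by move=> v; apply: D_lip; exact: le_trans rho_le1.
have M_continuous : continuous M.
  by move=> w; exact: differentiable_continuous.
have growth : forall r d y w, adm r (d, y) -> `|D w d| <= (k + l * `|w|) * `|d|.
  move=> r d y w /adm_growth h; apply: le_trans (h w) _.
  by rewrite ler_wpM2r// lerD2r.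
pose X := b ^+ 2 * k; pose Y := l * (2 * b ^+ 2 * k + 1).
have b20 : 0 < b ^+ 2 by exact: exprn_gt0.
have X0 : 0 < X by exact: mulr_gt0.
have Y0 : 0 < Y by apply: mulr_gt0 => //; rewrite addr_gt0// mulr_gt0// mulr_gt0.
have [eta [eta0 etaX etab]] : exists eta : R, [/\ 0 < eta,
    eta * X ^+ 2 <= alpha * mu / 4 & eta * b ^+ 2 <= alpha / 2].
  have p1 : 0 < alpha * mu / 4 by rewrite divr_gt0// mulr_gt0.
  have p2 : 0 < alpha / 2 by rewrite divr_gt0.
  have [|r [r0 _ rs]] :=
      small_radius (s := [:: (X ^+ 2, alpha * mu / 4); (b ^+ 2, alpha / 2)]).
    by move=> p; rewrite !inE => /orP[]/eqP->; split=> //; exact: exprn_gt0.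
  have rX := rs (X ^+ 2, alpha * mu / 4); have rb := rs (b ^+ 2, alpha / 2).
  by exists r; split => //; rewrite mulrC ltW//; [apply: rX|apply: rb];
    rewrite !inE eqxx ?orbT.
have [kappa [kappa0 ka km]] : exists kappa : R, [/\ 0 < kappa,
    kappa <= alpha / 4 & kappa <= mu / 2].
  exists (Num.min (alpha / 4) (mu / 2)).
  by split; rewrite ?lt_min ?divr_gt0// ge_min lexx ?orbT.
(* Below this level of V1, |w - w1| < rho / 2, so w stays in the ball of
   radius rho when |w1| < rho / 2. *)
pose v := eta * rho ^+ 2 / 4.
have v0 : 0 < v by rewrite divr_gt0// mulr_gt0// exprn_gt0.
pose Q := 2 * eta / alpha + 2 * (1 + k) ^+ 2 / lambda.
have Q0 : 0 < Q.
  apply: addr_gt0; apply: divr_gt0 => //; apply: mulr_gt0 => //.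
  by rewrite exprn_gt0// addr_gt0.
have [r [r0 [r1 r2 r3 r4] [r5 r6 r7]]] : exists r : R, [/\ 0 < r,
    [/\ b ^+ 2 * l * ((1 + c) * r) <= alpha / 4,
        (Y * ((1 + c) * r)) ^+ 2 <= eta * alpha * mu / 4,
        (l * r) ^+ 2 <= eta * alpha * lambda / 16 & r < s0] &
    [/\ c * r < rho / 2, (eta + 1) * (c * r) ^+ 2 < v / 8 &
        Q * r ^+ 2 / kappa < v / 8]].
  (* The smallness parameter of the local rate has to bound both the data, of
     size r, and the equilibrium error, of size c * r: hence the factor 1 + c. *)
  pose s := [:: (b ^+ 2 * l * (1 + c), alpha / 4);
    ((Y * (1 + c)) ^+ 2, eta * alpha * mu / 4);
    (l ^+ 2, eta * alpha * lambda / 16); (1, s0); (c, rho / 2);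
    ((eta + 1) * c ^+ 2, v / 8); (Q / kappa, v / 8)].
  have ea : 0 < eta * alpha by exact: mulr_gt0.
  have c10 : 0 < 1 + c by exact: addr_gt0.
  have q1 : 0 < b ^+ 2 * l * (1 + c) by rewrite mulr_gt0// mulr_gt0.
  have q2 : 0 < (Y * (1 + c)) ^+ 2 by apply: exprn_gt0; exact: mulr_gt0.
  have q3 : 0 < l ^+ 2 by exact: exprn_gt0.
  have q4 : 0 < (eta + 1) * c ^+ 2 by rewrite mulr_gt0 ?exprn_gt0// addr_gt0.
  have q5 : 0 < Q / kappa by exact: divr_gt0.
  have u1 : 0 < alpha / 4 by exact: divr_gt0.
  have u2 : 0 < eta * alpha * mu / 4 by apply: divr_gt0 => //; exact: mulr_gt0.
  have u3 : 0 < eta * alpha * lambda / 16.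
    by apply: divr_gt0 => //; exact: mulr_gt0.
  have u4 : 0 < rho / 2 by exact: divr_gt0.
  have u5 : 0 < v / 8 by exact: divr_gt0.
  have [p|r [r0 r1 rs]] := small_radius (s := s).
    by rewrite !inE; do ![case/orP=> [/eqP->//|]]; move=> /eqP->.
  have rr : r ^+ 2 <= r by rewrite expr2 ler_piMl// ltW.
  have [i1 i2 i3 i4] : [/\ b ^+ 2 * l * (1 + c) * r < alpha / 4,
    (Y * (1 + c)) ^+ 2 * r < eta * alpha * mu / 4, l ^+ 2 * r < eta * alpha * lambda / 16
    & 1 * r < s0].
    by split; [have := rs (b ^+ 2 * l * (1 + c), alpha / 4)|
      have := rs ((Y * (1 + c)) ^+ 2, eta * alpha * mu / 4)|
      have := rs (l ^+ 2, eta * alpha * lambda / 16)|have := rs (1, s0)];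
      apply; rewrite !inE eqxx ?orbT.
  have [i5 i6 i7] : [/\ c * r < rho / 2, (eta + 1) * c ^+ 2 * r < v / 8
     & Q / kappa * r < v / 8].
    by split; [have := rs (c, rho / 2)|have := rs ((eta + 1) * c ^+ 2, v / 8)|
      have := rs (Q / kappa, v / 8)]; apply; rewrite !inE eqxx ?orbT.
  exists r; split => //; split => //.
  - by rewrite mulrA ltW.
  - rewrite mulrA exprMn; apply: le_trans (ltW i2).
    by rewrite ler_wpM2l// ltW.
  - rewrite exprMn; apply: le_trans (ltW i3).
    by rewrite ler_wpM2l// exprn_ge0// ltW.
  - by rewrite -[r]mul1r.
  - apply: le_lt_trans i6; rewrite exprMn mulrA ler_wpM2l//.
    by rewrite mulr_ge0 ?exprn_ge0// ?addr_ge0// ltW.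
  - apply: le_lt_trans i7; rewrite mulrAC ler_wpM2l//.
    by rewrite divr_ge0// ltW.
pose V0 := lyap M eta 0 0.
pose cl := (1 + 2 * m ^+ 2) / eta + 2; pose cu := eta + 2 * m ^+ 2 + 2.
have m20 : 0 < m ^+ 2 by exact: exprn_gt0.
have cl0 : 0 < cl by rewrite addr_gt0// divr_gt0// addr_gt0// mulr_gt0.
have cu0 : 0 < cu by rewrite addr_gt0// addr_gt0// mulr_gt0.
exists (Num.sqrt (cl * cu)), kappa, r, [set p | V0 p < v / 8]; split => //.
- by rewrite sqrtr_gt0 mulr_gt0.
- have V0c : V0 p @[p --> (0 : H * Z)] --> V0 (0 : H * Z).
    exact: (cvg_lyap (F := nbhs (0 : H * Z)) M_continuous _ (xn := fun p => p) cvg_id).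
  have V00 : V0 (0 : H * Z) = 0.
    by rewrite /V0 /lyap/= M_zero !subr0 !normr0 !expr0n/= mulr0 addr0.
  move/cvgrPdist_lt : V0c => /(_ (v / 8) (divr_gt0 v0 _)) h.
  have {}h := h (ltr0n _ 8).
  apply: filterS h => p; rewrite V00 sub0r normrN => /(le_lt_trans (ler_norm _)).
  exact.
move=> d y dy; have [dr yr] := adm_small dy.
have [w1 [e1 [DA1 A1 D1 w1r e1r]]] := eqE d y r r4 dr yr.
have w1rho : `|w1| < rho / 2 by apply: le_lt_trans r5.
have w1rho' : `|w1| <= rho.
  by apply: le_trans (ltW w1rho) _; lra.
pose xstar := (w1, e1 + M w1).
have Cw1 : C w1 = y.
  have := sylvester DA1; rewrite A1 D1 addrC => /eqP; rewrite subr_eq0 => /eqP.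
  exact.
have V0star : eta * `|w1| ^+ 2 + `|e1| ^+ 2 < v / 8.
  apply: le_lt_trans r6; rewrite mulrDl mul1r.
  have cr0 : 0 <= c * r by rewrite mulr_ge0// ltW.
  by apply: lerD; rewrite ?ler_pM2l// ler_pXn2r// ?nnegrE.
pose V1 := lyap M eta w1 e1.
have V1w w z : V1 (w, z) < v -> `|w| <= rho.
  rewrite /V1 /lyap/= => h.
  have : eta * `|w - w1| ^+ 2 < eta * (rho / 2) ^+ 2.
    have : 0 <= `|z - M w - e1| ^+ 2 by rewrite exprn_ge0.
    by move: h; rewrite /v; lra.
  have rho20 : 0 <= rho / 2 by rewrite divr_ge0// ltW.
  rewrite ltr_pM2l// ltr_pXn2r// ?nnegrE// => {}h.
  have := ler_normD (w - w1) w1; rewrite subrK.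
  by move: h w1rho; lra.
have V01 p : V0 p < v / 4 -> V1 p < v.
  by move=> h; apply: le_lt_trans (lyap_recentre M w1 e1 p eta0) _;
    rewrite -/V0; move: h V0star; lra.
have V1_0 p : 0 <= V1 p.
  by rewrite /V1 /lyap addr_ge0 ?exprn_ge0// mulr_ge0 ?exprn_ge0// ltW.
have MV p : V1 p < v -> `|M p.1 - M w1| <= m * `|p.1 - w1|.
  move=> Vp; apply: Mm => //; apply: (V1w p.1 p.2).
  by rewrite -surjective_pairing.
have hV p : V1 p < v ->
    `|p.1 - w1| ^+ 2 + `|p.2 - (e1 + M w1)| ^+ 2 <= cl * V1 p.
  by move=> Vp; exact: sqr_dist_le_lyap (MV _ Vp).
have Vh p : V1 p < v ->
    V1 p <= cu * (`|p.1 - w1| ^+ 2 + `|p.2 - (e1 + M w1)| ^+ 2).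
  by move=> Vp; exact: lyap_le_sqr_dist (MV _ Vp).
have rate w z : DA w -> V1 (w, z) < v ->
    lyap_rate A B D P eta w1 e1 d y w (z - M w) <= - kappa * V1 (w, z).
  move=> DAw /V1w wrho.
  apply: (@local_lyap_rate _ _ _ _ A B D P pairing alpha b mu k l ((1 + c) * r)) => //.
  - by move=> u; exact: ub.
  - by move=> u; exact: Pb.
  - by move=> u; exact: Pb.
  - by move=> u; apply: D_lip; exact: le_trans rho_le1.
  - by move=> u; exact: Pl.
  - by move=> u; exact: sc.
  - exact: A_strong.
  - by apply: le_trans dr _; rewrite ler_peMl ?lerDl// ltW.
  - by apply: le_trans e1r _; rewrite ler_wpM2r ?lerDr// ltW.
have decay x : weak_solution DA A B C M d y x -> forall s t, 0 <= s -> s <= t ->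
    V1 (x s) < v -> V1 (x t) <= expR (- (2 * kappa * (t - s))) * V1 (x s).
  move=> xw s t; exact: (weak_trapped_decay M_differentiable dME feedbackE
    sylvester M_lipschitz eta0 M_continuous kappa0 rate xw).
exists xstar; split => //.
- by split => //=; rewrite feedbackE addrK.
- by rewrite /= /V0 /lyap/= !subr0 addrK.
- move=> x0 x x0N xw xE t t0.
  have v84 : V0 (x 0) < v / 4.
    by rewrite xE; apply: lt_trans x0N _; lra.
  have Vx := V01 _ v84.
  have := decay x xw 0 t (lexx 0) t0 Vx; rewrite subr0 => dec.
  have Vt : V1 (x t) < v.
    apply: le_lt_trans dec _; apply: le_lt_trans Vx.
    rewrite ler_piMl// -[leRHS]expR0 ler_expR oppr_le0 mulr_ge0//.
    by rewrite mulr_ge0// ltW.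
  rewrite -xE /hnorm /=.
  set a := `|_| ^+ 2 + _; set a0 := `|_| ^+ 2 + _.
  have a0_ge0 : 0 <= a0 by rewrite addr_ge0 ?sqr_ge0.
  have e0 := expR_ge0 (- (kappa * t)).
  have aa : a <= (cl * cu) * (expR (- (kappa * t)) ^+ 2 * a0).
    apply: le_trans (hV _ Vt) _.
    rewrite -mulrA ler_pM2l//; apply: le_trans dec _.
    have -> : expR (- (2 * kappa * t)) = expR (- (kappa * t)) ^+ 2.
      by rewrite -expRM_natl; congr expR; ring.
    rewrite mulrCA ler_wpM2l ?exprn_ge0//.
    exact: (Vh _ Vx).
  have -> : Num.sqrt (cl * cu) * expR (- (kappa * t)) * Num.sqrt a0 =
      Num.sqrt ((cl * cu) * (expR (- (kappa * t)) ^+ 2 * a0)).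
    have clu : 0 <= cl * cu by rewrite ltW// mulr_gt0.
    rewrite (sqrtrM _ clu) -mulrA; congr (_ * _).
    by rewrite sqrtrM ?exprn_ge0// sqrtr_sqr ger0_norm.
  exact: ler_wsqrtr.
move=> coer x0 x xw xE.
have grate w z : DA w -> lyap_rate A B D P eta 0 0 d y w (z - M w) <=
    - kappa * V0 (w, z) + Q * r ^+ 2.
  move=> DAw; rewrite /V0 /lyap/= !subr0.
  apply: (@global_lyap_rate _ _ _ _ A B D P pairing alpha b lambda k l r) => //.
  - exact: growth dy.
  - by have := A_strong DAw A_zero.1; rewrite A_zero.2 !subr0.
  - by apply: le_trans ka _; rewrite ler_pM2l// lef_pV2 ?posrE// ler_nat.
  - apply: le_trans km _; rewrite muE ler_pdivrMr// ler_peMr ?divr_ge0//.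
      exact: ltW.
    by rewrite ler1n.
have Qr0 : 0 <= Q * r ^+ 2 by rewrite mulr_ge0 ?sqr_ge0// ltW.
have gdec := weak_global_decay M_differentiable dME feedbackE
    sylvester M_lipschitz eta0 M_continuous kappa0 Qr0 grate xw.
pose c00 := V0 (x 0).
have c00_ge0 : 0 <= c00.
  by rewrite /c00 /V0 /lyap addr_ge0 ?exprn_ge0// mulr_ge0 ?exprn_ge0// ltW.
have k20 : 0 < 2 * kappa by exact: mulr_gt0.
have v80 : 0 < v / 8 by rewrite divr_gt0.
have [T0 T00 VT] := expRN_eventually_lt k20 c00_ge0 v80.
(* At time T0 the transient and the constant in the bound on V0 are both less
   than v / 8. *)
have VT0 : V1 (x T0) < v.
  apply: V01; apply: le_lt_trans (gdec T0 T00) _.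
  have -> : v / 4 = v / 8 + v / 8 by field.
  exact: ltrD (VT _ (lexx T0)) r7.
apply/cvgrPdist_lt => e e_gt0.
have clv0 : 0 <= cl * v by rewrite ltW// mulr_gt0.
have [T1 T10 eT] := expRN_eventually_lt k20 clv0 (exprn_gt0 2 e_gt0).
exists (T0 + T1); split; first exact: num_real.
move=> t tt.
have Tt : T0 <= t by apply: le_trans (ltW tt); rewrite lerDl.
have dec := decay x xw T0 t T00 Tt VT0.
have Vt : V1 (x t) < v.
  apply: le_lt_trans dec _; apply: le_lt_trans VT0.
  by rewrite ler_piMl// -[leRHS]expR0 ler_expR oppr_le0 mulr_ge0 ?subr_ge0// ltW.
have sq : `|(x t).1 - w1| ^+ 2 + `|(x t).2 - (e1 + M w1)| ^+ 2 < e ^+ 2.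
  apply: le_lt_trans (hV _ Vt) _.
  apply: le_lt_trans (eT (t - T0) _); last by rewrite lerBrDl ltW.
  rewrite [leRHS]mulrCA ler_pM2l//; apply: le_trans dec _.
  by rewrite ler_wpM2l ?expR_ge0// ltW.
rewrite distrC; rewrite prod_normE gt_max.
have e2 : 0 <= e by exact: ltW.
apply/andP; split; rewrite -(ltr_pXn2r (n := 2)) ?nnegrE//=.
  by apply: le_lt_trans sq; rewrite lerDl exprn_ge0.
by apply: le_lt_trans sq; rewrite lerDr exprn_ge0.
Qed.

End Stabilization.

(** * Proof of the stability theorem *)

Section LocallyLipschitzDifferential.
Variables (R : realType) (X : normedModType R) (Y : hilbertType R) (f : X -> Y).
Hypothesis f_differentiable : forall x, differentiable f x.
Hypothesis df_lipschitz : diff_locally_lipschitz f.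

Lemma diff_lipschitz_on_ball (rho : R) : exists2 l : R, 0 < l &
  forall x x' v, `|x| <= rho -> `|x'| <= rho ->
    `|'d f x v - 'd f x' v| <= l * `|x - x'| * `|v|.
Proof.
have bnd : bounded_set [set x : X | `|x| <= rho].
  exists rho; split; first exact: num_real.
  by move=> r rr x /= xrho; apply: le_trans xrho (ltW rr).
exact: diff_lipschitz_onP (df_lipschitz bnd).
Qed.

(** On a ball the differential is bounded, being Lipschitz and bounded at the
    origin. *)
Lemma lipschitz_on_ball (rho : R) : exists2 k : R, 0 < k &
  forall x x', `|x| <= rho -> `|x'| <= rho -> `|f x - f x'| <= k * `|x - x'|.
Proof.
have [rho0|rho0] := ltP rho 0.
  by exists 1 => // x x' xr; have := normr_ge0 x; rewrite leNgt (le_lt_trans xr).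
have [l l0 fl] := diff_lipschitz_on_ball rho.
have [k0 k00 fk] := continuous_linear_bound (diff_continuous (f_differentiable 0)).
have k0' : 0 < k0 + l * rho by rewrite ltr_pwDl// mulr_ge0// ltW.
exists (k0 + l * rho) => // x x' xr xr'.
apply: mean_value_inequality => // t v /andP[t0 t1].
set p := _ + _ *: _.
have pr : `|p| <= rho.
  have -> : p = (1 - t) *: x' + t *: x.
    by rewrite /p scalerBr scalerBl scale1r addrCA addrC.
  apply: le_trans (ler_normD _ _) _; rewrite !normrZ (ger0_norm t0) ger0_norm ?subr_ge0//.
  have -> : rho = (1 - t) * rho + t * rho by ring.
  by apply: lerD; rewrite ler_wpM2l// subr_ge0.
have := fl p 0 v pr; rewrite normr0 subr0 => /(_ rho0) h.
rewrite -['d f p v](subrK ('d f 0 v)); apply: le_trans (ler_normD _ _) _.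
rewrite addrC mulrDl; apply: lerD; first exact: fk.
by apply: le_trans h _; rewrite ler_wpM2r// ler_wpM2l// ltW.
Qed.

End LocallyLipschitzDifferential.

Theorem theorem3p2 (R : realType) (H Z U : hilbertType R)
  (DA : set H) (A : H -> H) (B : {linear U -> H})
  (DC : set H) (C : H -> Z) (M : H -> Z) (lambda : R)
  (DA_dense : dense DA)
  (A_maxmono : maximal_monotone DA A)
  (A_0 : DA 0 /\ A 0 = 0)
  (B_bounded : continuous B)
  (DC_dense : dense DC)
  (DA_sub_DC : DA `<=` DC)
  (C_linear : linear_with_domain DC C)
  (A_strong : strongly_monotone DA A)
  (M_C1 : C1 M)
  (M_0 : M 0 = 0)
  (M_sylvester : forall w, DA w -> 'd M w (A w) + C w = 0)
  (lambda_gt0 : 0 < lambda)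
  (range_cond : forall z : Z,
     lambda * `|z| ^+ 2 <= `|adjoint B (adjoint ('d M 0) z)| ^+ 2)
  (* admissible [d, yref] of size less than r: the "globally" case and the
     "locally" case *)
  (adm : R -> set (H * Z))
  (dM_lipschitz :
     (diff_globally_lipschitz M /\
        adm = (fun r => [set p | hnorm p < r])) \/
     (diff_locally_lipschitz M /\
        adm = (fun r => [set p | p.1 = 0 /\ `|p.2| < r]))) :
  exists (K kappa r : R) (N : set (H * Z)),
    [/\ 0 < K, 0 < kappa, 0 < r, nbhs (0 : H * Z) N &
      forall (d : H) (yref : Z), adm r (d, yref) ->
        exists xstar : H * Z,
          [/\ equilibrium DA A B C M d yref xstar,
              N xstar,
              C xstar.1 = yref,
              (forall (x0 : H * Z) (x : R -> H * Z), N x0 ->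
                 weak_solution DA A B C M d yref x -> x 0 = x0 ->
                 forall t : R, 0 <= t ->
                   hnorm (x t - xstar) <=
                     K * expR (- (kappa * t)) * hnorm (x0 - xstar)) &
              ((forall (w : H) (z : Z),
                  lambda * `|z| ^+ 2 <=
                    `|adjoint B (adjoint ('d M w) z)| ^+ 2) ->
               forall (x0 : H * Z) (x : R -> H * Z),
                 weak_solution DA A B C M d yref x -> x 0 = x0 ->
                 x t @[t --> +oo] --> xstar)]].
Proof.
have M_diff := M_C1.1.
have M_loc : diff_locally_lipschitz M.
  case: dM_lipschitz => [[[L ML] _] S _|[//]].
  by exists L => w w' _ _; exact: ML.
have [alpha alpha0 A_mono] := A_strong.
have [b b0 B_bound] := continuous_linear_bound B_bounded.
have [k0 k00 D0] := continuous_linear_bound (diff_continuous (M_diff 0)).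
have dM_cont w : continuous ('d M w) by exact: diff_continuous.
have [l [l0 Dl grow]] : exists l : R, [/\ 0 < l,
    forall w w' v, `|w| <= 1 -> `|w'| <= 1 ->
      `|'d M w v - 'd M w' v| <= l * `|w - w'| * `|v| &
    forall r d y w, adm r (d, y) -> `|'d M w d| <= (k0 + l * `|w|) * `|d|].
  case: dM_lipschitz => [[M_glob ->]|[_ ->]]; last first.
    have [l l0 Dl] := diff_lipschitz_on_ball M_diff M_loc 1.
    exists l; split => // r d y w [/= -> _].
    by rewrite linear0 !normr0 mulr0.
  have [l l0 Dl] := diff_lipschitz_onP M_diff M_glob.
  exists l; split => // [w w' v _ _|r d y w _]; first exact: Dl.
  rewrite -['d M w d](subrK ('d M 0 d)); apply: le_trans (ler_normD _ _) _.
  rewrite addrC mulrDl; apply: lerD; first exact: D0.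
  by have := Dl w 0 d I I; rewrite subr0.
have small r d y : adm r (d, y) -> `|d| <= r /\ `|y| <= r.
  case: dM_lipschitz => [[_ ->]|[_ ->]] /=; last first.
    by move=> [-> yr]; rewrite normr0; split; [exact: le_trans (ltW yr)|exact: ltW].
  rewrite /hnorm /= => dyr.
  have le_hnorm (s t : R) : 0 <= s -> s <= Num.sqrt (s ^+ 2 + t ^+ 2).
    move=> s0; rewrite -{1}(ger0_norm s0) -sqrtr_sqr.
    by apply: ler_wsqrtr; rewrite lerDl sqr_ge0.
  split; apply: le_trans (ltW dyr); first exact: le_hnorm.
  by rewrite addrC; exact: le_hnorm.
have pairing w u z :
    '<['d M w (B u), z]> = '<[u, adjoint B (adjoint ('d M w) z)]>.
  by rewrite adjointP//; exact: adjointP.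
exact: (@stabilization R H Z U DA A B C M (fun w => 'd M w)
  (fun w z => adjoint B (adjoint ('d M w) z)) alpha b k0 l lambda adm
  M_diff (fun w v => erefl) pairing (fun w z => erefl) M_sylvester
  (lipschitz_on_ball M_diff M_loc) M_0 A_maxmono A_0 A_mono alpha0 b0 k00 l0
  lambda_gt0 B_bound D0 Dl range_cond small grow).
Qed.
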